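(* Let $E=\{x_1,\dots,x_n\}\subset\mathbb{R}^2$ with $x_i\,\mathcal{I}\,x_j$ for all $i\neq j$. The Max-Sum-Min $p$-dispersion problem is polynomially solvable to optimality in $E$. The cases $p=2,3$ are solvable in $O(n)$ time using $O(1)$ additional memory space. The case $p=4$ (resp. $p=5$) is solvable in $O(n^2)$ (resp. $O(n^3)$) time using $O(1)$ additional memory space. For $p>5$ there is an algorithm (a dynamic programming algorithm) that solves it, returning the optimal value and an optimal selection, in $O(pn^3)$ time and $O(pn^2)$ memory space.
   Context: For $y=(y^1,y^2),z=(z^1,z^2)\in\mathbb{R}^2$ write $y\prec z$ iff $y^1<z^1$ and $y^2>z^2$, and $y\,\mathcal{I}\,z$ iff $y\prec z$ or $z\prec y$ (so $E$ is a two-dimensional Pareto front). Fix $\alpha>0$ and let $d$ be the Euclidean distance on $\mathbb{R}^2$. For an integer $2\le p\le n$, let $D_p$ be the set of $p$-tuples $(z_1,\dots,z_p)\in E^p$ of pairwise distinct points. The Max-Sum-Min $p$-dispersion problem is $\max_{(z_1,\dots,z_p)\in D_p}\sum_{i=1}^{p}\min_{j\neq i,\,1\le j\le p}d(z_i,z_j)^\alpha$. Complexities are in a model where arithmetic operations, comparisons and evaluation of $d(\cdot,\cdot)^\alpha$ take $O(1)$ time; ''additional memory space'' excludes the storage of the input. *)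

(* Defs.v *)
From Stdlib Require Import Reals List Arith.
Import ListNotations.
Open Scope R_scope.

Definition pt : Type := (R * R)%type.

Definition prec (y z : pt) : Prop := fst y < fst z /\ snd y > snd z.
Definition incomp (y z : pt) : Prop := prec y z \/ prec z y.

Definition edist (y z : pt) : R :=
  sqrt ((fst y - fst z) ^ 2 + (snd y - snd z) ^ 2).

(* d(y,z)^alpha, with the convention 0^alpha = 0 (alpha > 0) *)
Definition dpow (alpha : R) (y z : pt) : R :=
  if Req_EM_T (edist y z) 0 then 0 else Rpower (edist y z) alpha.

Definition getpt (E : list pt) (i : nat) : pt := nth i E (0, 0).

Definition pareto_set (E : list pt) : Prop :=
  forall i j, (i < length E)%nat -> (j < length E)%nat -> i <> j ->
    incomp (getpt E i) (getpt E j).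

Definition minl (l : list R) : R :=
  match l with [] => 0 | x :: t => fold_left Rmin t x end.

Definition sumR (l : list R) : R := fold_right Rplus 0 l.

(* A selection is a list of indices into E (points of E are pairwise distinct,
   so p pairwise distinct points of E = p pairwise distinct indices). *)
Definition others (q k : nat) : list nat :=
  filter (fun l => negb (Nat.eqb l k)) (seq 0 q).

Definition disp_value (alpha : R) (E : list pt) (sel : list nat) : R :=
  sumR (map (fun k =>
          minl (map (fun l => dpow alpha (getpt E (nth k sel 0%nat))
                                         (getpt E (nth l sel 0%nat)))
                    (others (length sel) k)))
        (seq 0 (length sel))).

Definition feasible (E : list pt) (p : nat) (sel : list nat) : Prop :=
  length sel = p /\ NoDup sel /\ Forall (fun i => (i < length E)%nat) sel.

Definition optimal (alpha : R) (E : list pt) (p : nat) (sel : list nat) : Prop :=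
  feasible E p sel /\
  forall sel', feasible E p sel' -> disp_value alpha E sel' <= disp_value alpha E sel.

(* Two register files: natural-number registers N[.] and real registers R[.],
   both indexed by nat, with indirect addressing.  The input (n points, p) is
   read-only and is not stored in registers.  The instruction
   RDist computes d(x_a, x_b)^alpha in one step. *)
Inductive instr : Type :=
| NConst (d k : nat)
| NAdd (d a b : nat)
| NSub (d a b : nat)
| NMul (d a b : nat)
| NLoad (d a : nat)
| NStore (a s : nat)
| NSize (d : nat)
| NParam (d : nat)
| RConst (d k : nat)
| RMove (d s : nat)
| RAdd (d a b : nat)
| RSub (d a b : nat)
| RMul (d a b : nat)
| RLoad (d a : nat)
| RStore (a s : nat)
| RLoadX (d a : nat)
| RLoadY (d a : nat)
| RDist (d a b : nat)
| JNLe (a b t : nat)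
| JRLe (a b t : nat)
| Jmp (t : nat)
| Halt.

Record state : Type := mkState {
  pc : nat;
  nreg : nat -> nat;
  rreg : nat -> R;
  mem : nat  (* 1 + largest register index touched so far (both files) *)
}.

Definition init_state : state := mkState 0 (fun _ => 0%nat) (fun _ => 0) 0.

Definition updN (f : nat -> nat) (i v : nat) : nat -> nat :=
  fun j => if Nat.eqb j i then v else f j.
Definition updR (f : nat -> R) (i : nat) (v : R) : nat -> R :=
  fun j => if Nat.eqb j i then v else f j.

Definition touch (m : nat) (l : list nat) : nat :=
  fold_left (fun acc i => Nat.max acc (S i)) l m.

Definition step (alpha : R) (E : list pt) (p : nat) (P : list instr) (s : state)
  : option state :=
  let N := nreg s in let Rg := rreg s in let m := mem s in let nx := S (pc s) in
  match nth_error P (pc s) with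
  | None => None
  | Some ins =>
    match ins with
    | NConst d k => Some (mkState nx (updN N d k) Rg (touch m [d]))
    | NAdd d a b => Some (mkState nx (updN N d (N a + N b)) Rg (touch m [d; a; b]))
    | NSub d a b => Some (mkState nx (updN N d (N a - N b)) Rg (touch m [d; a; b]))
    | NMul d a b => Some (mkState nx (updN N d (N a * N b)) Rg (touch m [d; a; b]))
    | NLoad d a => Some (mkState nx (updN N d (N (N a))) Rg (touch m [d; a; N a]))
    | NStore a s' => Some (mkState nx (updN N (N a) (N s')) Rg (touch m [a; s'; N a]))
    | NSize d => Some (mkState nx (updN N d (length E)) Rg (touch m [d]))
    | NParam d => Some (mkState nx (updN N d p) Rg (touch m [d]))
    | RConst d k => Some (mkState nx N (updR Rg d (INR k)) (touch m [d]))
    | RMove d s' => Some (mkState nx N (updR Rg d (Rg s')) (touch m [d; s']))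
    | RAdd d a b => Some (mkState nx N (updR Rg d (Rg a + Rg b)) (touch m [d; a; b]))
    | RSub d a b => Some (mkState nx N (updR Rg d (Rg a - Rg b)) (touch m [d; a; b]))
    | RMul d a b => Some (mkState nx N (updR Rg d (Rg a * Rg b)) (touch m [d; a; b]))
    | RLoad d a => Some (mkState nx N (updR Rg d (Rg (N a))) (touch m [d; a; N a]))
    | RStore a s' => Some (mkState nx N (updR Rg (N a) (Rg s')) (touch m [a; s'; N a]))
    | RLoadX d a => Some (mkState nx N (updR Rg d (fst (getpt E (N a)))) (touch m [d; a]))
    | RLoadY d a => Some (mkState nx N (updR Rg d (snd (getpt E (N a)))) (touch m [d; a]))
    | RDist d a b =>
        Some (mkState nx N (updR Rg d (dpow alpha (getpt E (N a)) (getpt E (N b))))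
                      (touch m [d; a; b]))
    | JNLe a b t =>
        Some (mkState (if Nat.leb (N a) (N b) then t else nx) N Rg (touch m [a; b]))
    | JRLe a b t =>
        Some (mkState (if Rle_dec (Rg a) (Rg b) then t else nx) N Rg (touch m [a; b]))
    | Jmp t => Some (mkState t N Rg m)
    | Halt => None
    end
  end.

Fixpoint run (alpha : R) (E : list pt) (p : nat) (P : list instr) (fuel : nat)
  (s : state) : state :=
  match fuel with
  | O => s
  | S f => match step alpha E p P s with
           | None => s
           | Some s' => run alpha E p P f s'
           end
  end.

Definition output_sel (p : nat) (s : state) : list nat := map (nreg s) (seq 1 p).

Definition correct_output (alpha : R) (E : list pt) (p : nat) (s : state) : Prop :=
  optimal alpha E p (output_sel p s) /\
  rreg s 0%nat = disp_value alpha E (output_sel p s).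

Definition solves_within (alpha : R) (P : list instr) (E : list pt) (p T M : nat)
  : Prop :=
  let s := run alpha E p P T init_state in
  step alpha E p P s = None /\ (mem s <= M)%nat /\ correct_output alpha E p s.

(* Main.v *)
Require Import Defs.
From Stdlib Require Import Reals List Arith.
From Stdlib Require Import Lia Lra Permutation Sorted FunctionalExtensionality.
Import ListNotations.
Open Scope R_scope.

(** Both coordinates are monotone along the front, so the distance between the
    endpoints of an interval grows with the interval. Hence the nearest selected
    point is a neighbour in the order of abscissae, and moving the two extreme
    selected points to the ends of the front only increases the objective. For
    fixed [p] this leaves [p - 2] points to enumerate between the two ends. In
    general, let [V t j l] be the best sum of the first [t] minima over increasing
    chains of [t + 1] points ending with [j], [l]; then
    [V (t+1) j l = max_i (V t i j + min (D i j) (D j l))], and the objective of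
    the chain is [V + D j l]. The input is never sorted: pairs in the wrong order
    are marked by a negative value. *)

(** * Structured programs *)

(** The bounds concern runs of concrete jump code, so correctness, running time and the highest
    register touched must be proved of one and the same run. Programs are therefore written with
    structured control, compiled once, and treated by a weakest-precondition calculus that carries
    the unspent time. Sorting would need a copy of the read-only input, hence linear memory;
    comparing abscissae on the fly costs only a constant factor. The partial sums leave out the
    rightmost point because its minimum is open until the next point is known, whereas all earlier
    minima are final: any later point lies beyond the current right neighbour. This is why two
    points suffice as state, giving [n^2] entries per level with [n] candidates each. All objective
    values are nonnegative, so -1 can mark that nothing has been found yet. *)

Inductive com : Type :=
| Ins (i : instr)
| Skip
| Seq (a b : com)
| IfR (a b : nat) (c1 c2 : com)
| For (d b : nat) (c : com).

Infix ";;" := Seq (at level 62, right associativity).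

Fixpoint size (c : com) : nat :=
  match c with
  | Ins _ => 1
  | Skip => 0
  | Seq a b => size a + size b
  | IfR _ _ c1 c2 => S (size c2 + S (size c1))
  | For _ _ c => S (size c + 3)
  end.

(* [IfR a b c1 c2] runs [c1] when R[a] <= R[b]; [For d b c] repeats [c] while
   N[d] < N[b], incrementing N[d] and using N[0] as scratch. *)
Fixpoint compile (c : com) (base : nat) : list instr :=
  match c with
  | Ins i => [i]
  | Skip => []
  | Seq a b => compile a base ++ compile b (base + size a)
  | IfR a b c1 c2 =>
      JRLe a b (base + size c2 + 2) :: compile c2 (base + 1) ++
      Jmp (base + size c2 + 2 + size c1) :: compile c1 (base + size c2 + 2)
  | For d b c =>
      JNLe b d (base + size c + 4) :: compile c (base + 1) ++
      [NConst 0 1; NAdd d d 0; Jmp base]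
  end.

Lemma length_compile (c : com) : forall base, length (compile c base) = size c.
Proof.
  induction c; intros base; simpl; try reflexivity.
  - rewrite length_app, IHc1, IHc2; reflexivity.
  - rewrite length_app; simpl; rewrite IHc1, IHc2; reflexivity.
  - rewrite length_app, IHc; reflexivity.
Qed.

Definition straight (i : instr) : Prop :=
  match i with JNLe _ _ _ | JRLe _ _ _ | Jmp _ | Halt => False | _ => True end.

Lemma touch_le (M m : nat) (l : list nat) :
  (m <= M)%nat -> Forall (fun i => (i < M)%nat) l -> (touch m l <= M)%nat.
Proof.
  intros Hm Hl; revert m Hm; induction Hl; intros m Hm; simpl; [exact Hm|].
  apply IHHl; lia.
Qed.

Lemma updN_eq (f : nat -> nat) (i v : nat) : updN f i v i = v.
Proof. unfold updN; now rewrite Nat.eqb_refl. Qed.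

Lemma updN_neq (f : nat -> nat) (i v j : nat) : j <> i -> updN f i v j = f j.
Proof. unfold updN; intros H; apply Nat.eqb_neq in H; now rewrite H. Qed.

Lemma updN_updN (f : nat -> nat) (i a b : nat) : updN (updN f i a) i b = updN f i b.
Proof.
  apply functional_extensionality; intros j; unfold updN; now destruct (Nat.eqb j i).
Qed.

Lemma updR_eq (f : nat -> R) (i : nat) (v : R) : updR f i v i = v.
Proof. unfold updR; now rewrite Nat.eqb_refl. Qed.

Lemma updR_neq (f : nat -> R) (i : nat) (v : R) (j : nat) :
  j <> i -> updR f i v j = f j.
Proof. unfold updR; intros H; apply Nat.eqb_neq in H; now rewrite H. Qed.

(** * Weakest preconditions with time and memory budgets *)

Section Logic.
Variables (alpha : R) (E : list pt) (p M : nat).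

Definition effN (i : instr) (N : nat -> nat) : nat -> nat :=
  match i with
  | NConst d k => updN N d k
  | NAdd d a b => updN N d (N a + N b)
  | NSub d a b => updN N d (N a - N b)
  | NMul d a b => updN N d (N a * N b)
  | NLoad d a => updN N d (N (N a))
  | NStore a s => updN N (N a) (N s)
  | NSize d => updN N d (length E)
  | NParam d => updN N d p
  | _ => N
  end.

Definition effR (i : instr) (N : nat -> nat) (Rg : nat -> R) : nat -> R :=
  match i with
  | RConst d k => updR Rg d (INR k)
  | RMove d s => updR Rg d (Rg s)
  | RAdd d a b => updR Rg d (Rg a + Rg b)
  | RSub d a b => updR Rg d (Rg a - Rg b)
  | RMul d a b => updR Rg d (Rg a * Rg b)
  | RLoad d a => updR Rg d (Rg (N a))
  | RStore a s => updR Rg (N a) (Rg s)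
  | RLoadX d a => updR Rg d (fst (getpt E (N a)))
  | RLoadY d a => updR Rg d (snd (getpt E (N a)))
  | RDist d a b => updR Rg d (dpow alpha (getpt E (N a)) (getpt E (N b)))
  | _ => Rg
  end.

Definition touched (i : instr) (N : nat -> nat) : list nat :=
  match i with
  | NConst d _ | NSize d | NParam d | RConst d _ => [d]
  | NAdd d a b | NSub d a b | NMul d a b | RAdd d a b | RSub d a b
  | RMul d a b | RDist d a b => [d; a; b]
  | NLoad d a | RLoad d a => [d; a; N a]
  | NStore a s | RStore a s => [a; s; N a]
  | RMove d a | RLoadX d a | RLoadY d a => [d; a]
  | _ => []
  end.

Lemma step_straight (P : list instr) (i : instr) (s : state) :
  straight i -> nth_error P (pc s) = Some i ->
  step alpha E p P s = Some (mkState (S (pc s)) (effN i (nreg s))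
    (effR i (nreg s) (rreg s)) (touch (mem s) (touched i (nreg s)))).
Proof. intros Hi Hn; unfold step; rewrite Hn; destruct i; easy. Qed.

Definition assertion : Type := (nat -> nat) -> (nat -> R) -> Prop.

(** Quantifying over the remaining fuel [f] lets segments compose by adding their lengths. *)
Definition reaches (P : list instr) (t : nat) (s s' : state) : Prop :=
  forall f, run alpha E p P (t + f) s = run alpha E p P f s'.

(* [wp c Q w N Rg]: from registers [N], [Rg] the code of [c], wherever it is
   placed, touches only registers below [M] and ends with [Q w'] holding, where
   [w'] is what remains of the time budget [w]. *)
Definition wp (c : com) (Q : nat -> assertion) (w : nat) : assertion :=
  fun N Rg => forall pre post base m,
    base = length pre -> (m <= M)%nat ->
    let P := pre ++ compile c base ++ post in
    exists t w' N' R' m', (t + w' <= w)%nat /\ (m' <= M)%nat /\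
      reaches P t (mkState base N Rg m) (mkState (base + size c) N' R' m') /\
      Q w' N' R'.

Lemma reaches_trans (P : list instr) (t1 t2 : nat) (s1 s2 s3 : state) :
  reaches P t1 s1 s2 -> reaches P t2 s2 s3 -> reaches P (t1 + t2) s1 s3.
Proof. intros H1 H2 f. rewrite <- Nat.add_assoc, H1. apply H2. Qed.

Lemma reaches_step (P : list instr) (s s' : state) :
  step alpha E p P s = Some s' -> reaches P 1 s s'.
Proof. intros H f; simpl; now rewrite H. Qed.

Lemma nth_error_mid (A : Type) (pre post : list A) (x : A) (k : nat) :
  k = length pre -> nth_error (pre ++ x :: post) k = Some x.
Proof.
  intros ->; rewrite nth_error_app2, Nat.sub_diag by lia; reflexivity.
Qed.

Lemma reaches_straight (P pre post : list instr) (i : instr) (k : nat) N Rg m :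
  straight i -> P = pre ++ i :: post -> k = length pre ->
  reaches P 1 (mkState k N Rg m)
    (mkState (S k) (effN i N) (effR i N Rg) (touch m (touched i N))).
Proof.
  intros Hi -> Hk; apply reaches_step.
  apply step_straight; [exact Hi|]; now apply nth_error_mid.
Qed.

Lemma reaches_jmp (P pre post : list instr) (t k : nat) N Rg m :
  P = pre ++ Jmp t :: post -> k = length pre ->
  reaches P 1 (mkState k N Rg m) (mkState t N Rg m).
Proof.
  intros -> Hk; apply reaches_step; unfold step; simpl.
  now rewrite nth_error_mid.
Qed.

Lemma reaches_jnle (P pre post : list instr) (a b t k : nat) N Rg m :
  P = pre ++ JNLe a b t :: post -> k = length pre ->
  reaches P 1 (mkState k N Rg m)
    (mkState (if Nat.leb (N a) (N b) then t else S k) N Rg (touch m [a; b])).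
Proof.
  intros -> Hk; apply reaches_step; unfold step; simpl.
  now rewrite nth_error_mid.
Qed.

Lemma reaches_jrle (P pre post : list instr) (a b t k : nat) N Rg m :
  P = pre ++ JRLe a b t :: post -> k = length pre ->
  reaches P 1 (mkState k N Rg m)
    (mkState (if Rle_dec (Rg a) (Rg b) then t else S k) N Rg (touch m [a; b])).
Proof.
  intros -> Hk; apply reaches_step; unfold step; simpl.
  now rewrite nth_error_mid.
Qed.

Lemma wp_ins (i : instr) (Q : nat -> assertion) (w : nat) N Rg :
  straight i -> (1 <= w)%nat ->
  Forall (fun r => (r < M)%nat) (touched i N) ->
  Q (w - 1)%nat (effN i N) (effR i N Rg) -> wp (Ins i) Q w N Rg.
Proof.
  intros Hi Hw HM HQ pre post base m Hb Hm P.
  exists 1%nat, (w - 1)%nat, (effN i N), (effR i N Rg), (touch m (touched i N)).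
  repeat split; [lia|now apply touch_le| |exact HQ].
  simpl; rewrite Nat.add_1_r; eapply reaches_straight; [exact Hi|reflexivity|exact Hb].
Qed.

Lemma wp_skip (Q : nat -> assertion) (w : nat) N Rg : Q w N Rg -> wp Skip Q w N Rg.
Proof.
  intros HQ pre post base m Hb Hm P.
  exists 0%nat, w, N, Rg, m; repeat split; auto.
  simpl; rewrite Nat.add_0_r; intros f; reflexivity.
Qed.

Lemma wp_seq (a b : com) (Q : nat -> assertion) (w : nat) N Rg :
  wp a (wp b Q) w N Rg -> wp (Seq a b) Q w N Rg.
Proof.
  intros H pre post base m Hb Hm P.
  destruct (H pre (compile b (base + size a) ++ post) base m Hb Hm)
    as (t1 & w1 & N1 & R1 & m1 & Ht1 & Hm1 & Hr1 & H1).
  destruct (H1 (pre ++ compile a base) post (base + size a)%nat m1)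
    as (t2 & w2 & N2 & R2 & m2 & Ht2 & Hm2 & Hr2 & H2);
    [rewrite length_app, length_compile; lia|exact Hm1|].
  exists (t1 + t2)%nat, w2, N2, R2, m2; repeat split; [lia|exact Hm2| |exact H2].
  simpl size; rewrite Nat.add_assoc.
  eapply reaches_trans.
  - unfold P; simpl compile; rewrite <- app_assoc; exact Hr1.
  - unfold P; simpl compile; rewrite <- app_assoc.
    rewrite <- app_assoc in Hr2; exact Hr2.
Qed.

(** The bound [v] is charged in full even if [c] finishes sooner, so the remaining budget is an
    explicit number that does not depend on the branches taken. *)
Lemma wp_call (c : com) (A : assertion) (Q : nat -> assertion) (v w : nat) N Rg :
  wp c (fun _ => A) v N Rg -> (v <= w)%nat ->
  (forall N' R', A N' R' -> Q (w - v)%nat N' R') -> wp c Q w N Rg.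
Proof.
  intros H Hw HQ pre post base m Hb Hm P.
  destruct (H pre post base m Hb Hm)
    as (t1 & w1 & N1 & R1 & m1 & Ht1 & Hm1 & Hr1 & H1).
  exists t1, (w - v)%nat, N1, R1, m1; repeat split; auto; lia.
Qed.

(** Both branches are charged 2: the test, and the jump over [c1] that ends [c2]. *)
Lemma wp_ifR (a b : nat) (c1 c2 : com) (Q : nat -> assertion) (w : nat) N Rg :
  (2 <= w)%nat -> (a < M)%nat -> (b < M)%nat ->
  (Rg a <= Rg b -> wp c1 Q (w - 2) N Rg) ->
  (Rg b < Rg a -> wp c2 Q (w - 2) N Rg) -> wp (IfR a b c1 c2) Q w N Rg.
Proof.
  intros Hw Ha HB H1 H2 pre post base m Hb Hm P.
  set (j1 := (base + size c2 + 2)%nat).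
  set (i0 := JRLe a b j1).
  set (i1 := Jmp (base + size c2 + 2 + size c1)).
  assert (HP : P = pre ++ i0 :: compile c2 (base + 1) ++ i1 :: compile c1 j1 ++ post).
  { unfold P; simpl; now rewrite <- app_assoc. }
  assert (Hm1 : (touch m [a; b] <= M)%nat) by (apply touch_le; auto).
  pose proof (reaches_jrle P pre _ a b j1 base N Rg m HP Hb) as Hs.
  destruct (Rle_dec (Rg a) (Rg b)) as [Hle|Hgt].
  - destruct (H1 Hle (pre ++ i0 :: compile c2 (base + 1) ++ [i1]) post j1
      (touch m [a; b])) as (t & w' & N' & R' & m' & Ht & Hm' & Hr & HQ); [|exact Hm1|].
    { rewrite !length_app; simpl; rewrite length_app, length_compile; simpl.
      unfold j1; lia. }
    exists (1 + t)%nat, w', N', R', m'; repeat split; [lia|exact Hm'| |exact HQ].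
    eapply reaches_trans; [exact Hs|].
    replace (base + size (IfR a b c1 c2))%nat with (j1 + size c1)%nat
      by (unfold j1; simpl; lia).
    rewrite HP; repeat (rewrite <- app_assoc in Hr; simpl in Hr); exact Hr.
  - apply Rnot_le_lt in Hgt.
    destruct (H2 Hgt (pre ++ [i0]) (i1 :: compile c1 j1 ++ post) (base + 1)%nat
      (touch m [a; b])) as (t & w' & N' & R' & m' & Ht & Hm' & Hr & HQ); [|exact Hm1|].
    { rewrite length_app; simpl; lia. }
    rewrite <- app_assoc in Hr; simpl in Hr.
    exists (1 + (t + 1))%nat, w', N', R', m'; repeat split; [lia|exact Hm'| |exact HQ].
    eapply reaches_trans; [exact Hs|].
    replace (S base) with (base + 1)%nat by lia.
    eapply reaches_trans.
    { rewrite HP; exact Hr. }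
    eapply reaches_jmp with (pre := pre ++ i0 :: compile c2 (base + 1))
      (post := compile c1 j1 ++ post).
    + rewrite HP; simpl; rewrite <- app_assoc; simpl.
      repeat f_equal; unfold i1; f_equal; lia.
    + rewrite length_app; simpl; rewrite length_compile; lia.
Qed.

(** Each round adds four instructions to the body (test, constant, increment, jump back), and the
    final test adds one. The invariant is re-established after the writes to the scratch register 0
    and to the counter. *)
Lemma wp_for (d b n i0 wb : nat) (c : com) (I : nat -> assertion)
  (Q : nat -> assertion) (w : nat) N Rg :
  (0 < M)%nat -> (d < M)%nat -> (b < M)%nat -> d <> 0%nat ->
  (i0 <= n)%nat ->
  (forall i N Rg, I i N Rg -> N d = i /\ N b = n) ->
  I i0 N Rg ->
  (forall i N Rg, (i0 <= i < n)%nat -> I i N Rg ->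
     wp c (fun _ N' R' => N' d = i /\ I (S i) (updN (updN N' 0 1) d (S i)) R') wb N Rg) ->
  (((n - i0) * (wb + 4) + 1) <= w)%nat ->
  (forall N' R', I n N' R' -> Q (w - ((n - i0) * (wb + 4) + 1))%nat N' R') ->
  wp (For d b c) Q w N Rg.
Proof.
  intros HM0 Hd Hbm Hd0 Hin Hreg HI Hbody Hw HQ pre post base m Hb Hm P.
  set (i1 := JNLe b d (base + size c + 4)).
  assert (HP : P = pre ++ i1 :: compile c (base + 1) ++
    NConst 0 1 :: NAdd d d 0 :: Jmp base :: post).
  { unfold P; simpl; rewrite <- app_assoc; reflexivity. }
  assert (Hloop : forall k i N Rg m, (i + k)%nat = n -> (i0 <= i)%nat -> I i N Rg ->
    (m <= M)%nat -> exists t N' R' m', (t <= k * (wb + 4) + 1)%nat /\ (m' <= M)%nat /\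
      reaches P t (mkState base N Rg m) (mkState (base + size (For d b c)) N' R' m') /\
      I n N' R').
  2:{ destruct (Hloop (n - i0)%nat i0 N Rg m) as (t & N' & R' & m' & Ht & Hm' & Hr & HI');
        [lia|lia|exact HI|exact Hm|].
      exists t, (w - ((n - i0) * (wb + 4) + 1))%nat, N', R', m'.
      repeat split; auto; lia. }
  clear N Rg m HI Hm HQ Hw w.
  induction k; intros i N Rg m Hik Hi HI Hm.
  - destruct (Hreg _ _ _ HI) as [Hdi Hbn].
    exists 1%nat, N, Rg, (touch m [b; d]); repeat split; [lia|apply touch_le; auto| |].
    + pose proof (reaches_jnle P pre _ b d _ base N Rg m HP Hb) as Hs.
      replace (Nat.leb (N b) (N d)) with true in Hs by (symmetry; apply Nat.leb_le; lia).
      replace (base + size (For d b c))%nat with (base + size c + 4)%nat by (simpl; lia).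
      exact Hs.
    + now replace n with i by lia.
  - destruct (Hreg _ _ _ HI) as [Hdi Hbn].
    assert (Hm1 : (touch m [b; d] <= M)%nat) by (apply touch_le; auto).
    destruct (Hbody i N Rg ltac:(lia) HI (pre ++ [i1])
      (NConst 0 1 :: NAdd d d 0 :: Jmp base :: post) (base + 1)%nat (touch m [b; d]))
      as (t & w' & N' & R' & m' & Ht & Hm' & Hr & HQ & HI');
      [rewrite length_app; simpl; lia|exact Hm1|].
    rewrite <- app_assoc in Hr; simpl in Hr.
    set (N2 := updN (updN N' 0 1) d (S i)) in *.
    set (m2 := touch (touch m' [0%nat]) [d; d; 0%nat]).
    assert (Hm2 : (m2 <= M)%nat) by (repeat apply touch_le; auto).
    destruct (IHk (S i) N2 R' m2) as (t2 & N3 & R3 & m3 & Ht2 & Hm3 & Hr2 & HI3);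
      [lia|lia|exact HI'|exact Hm2|].
    exists (1 + (t + (1 + (1 + (1 + t2)))))%nat, N3, R3, m3.
    repeat split; [nia|exact Hm3| |exact HI3].
    eapply reaches_trans.
    { pose proof (reaches_jnle P pre _ b d _ base N Rg m HP Hb) as Hs.
      replace (Nat.leb (N b) (N d)) with false in Hs by (symmetry; apply Nat.leb_gt; lia).
      exact Hs. }
    replace (S base) with (base + 1)%nat by lia.
    eapply reaches_trans; [rewrite HP; exact Hr|].
    eapply reaches_trans.
    { eapply reaches_straight with (i := NConst 0 1)
        (pre := pre ++ i1 :: compile c (base + 1)); [exact Logic.I| |].
      - rewrite HP; rewrite <- app_assoc; reflexivity.
      - rewrite length_app; simpl; rewrite length_compile; lia. }
    eapply reaches_trans.
    { eapply reaches_straight with (i := NAdd d d 0)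
        (pre := pre ++ i1 :: compile c (base + 1) ++ [NConst 0 1]); [exact Logic.I| |].
      - rewrite HP; rewrite <- app_assoc; simpl; rewrite <- app_assoc; reflexivity.
      - rewrite length_app; simpl; rewrite length_app, length_compile; simpl; lia. }
    eapply reaches_trans.
    { eapply reaches_jmp
        with (pre := pre ++ i1 :: compile c (base + 1) ++ [NConst 0 1; NAdd d d 0]).
      - rewrite HP; rewrite <- app_assoc; simpl; rewrite <- app_assoc; reflexivity.
      - rewrite length_app; simpl; rewrite length_app, length_compile; simpl; lia. }
    replace (effN (NAdd d d 0) (effN (NConst 0 1) N')) with N2; [exact Hr2|].
    unfold N2; simpl; rewrite updN_eq, updN_neq, HQ by assumption; f_equal; lia.
Qed.

Lemma wp_solves (c : com) (w : nat) :
  wp c (fun _ N Rg => optimal alpha E p (map N (seq 1 p)) /\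
                      Rg 0%nat = disp_value alpha E (map N (seq 1 p))) w
     (fun _ => 0%nat) (fun _ => 0) ->
  solves_within alpha (compile c 0 ++ [Halt]) E p w M.
Proof.
  intros H; destruct (H [] [Halt] 0%nat 0%nat eq_refl (Nat.le_0_l _))
    as (t & w' & N' & R' & m' & Ht & Hm' & Hr & HQ).
  simpl in Hr.
  assert (Hs : step alpha E p (compile c 0 ++ [Halt]) (mkState (size c) N' R' m') = None).
  { unfold step; simpl; rewrite nth_error_mid; [reflexivity|now rewrite length_compile]. }
  unfold solves_within; replace w with (t + (w - t))%nat by lia.
  unfold init_state; rewrite Hr.
  (* The machine now stands at [Halt], so the unspent fuel leaves the state unchanged. *)
  replace (run alpha E p (compile c 0 ++ [Halt]) (w - t) (mkState (size c) N' R' m'))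
    with (mkState (size c) N' R' m').
  - split; [exact Hs|]; split; [exact Hm'|exact HQ].
  - destruct (w - t)%nat; [reflexivity|]; cbn [run]; now rewrite Hs.
Qed.

End Logic.

Ltac upd := repeat match goal with
  | |- context [updN ?f ?i ?v ?j] =>
      first [rewrite (updN_eq f i v) | rewrite (updN_neq f i v j) by lia]
  | |- context [updR ?f ?i ?v ?j] =>
      first [rewrite (updR_eq f i v) | rewrite (updR_neq f i v j) by lia]
  end.

Ltac ins := apply wp_ins;
  [exact Logic.I | lia | cbn [touched]; once (repeat constructor); upd; try lia
  | cbn [effN effR]].
Ltac go := repeat first [apply wp_seq | ins].

(** The machine can copy real registers but has no such instruction for natural ones; clearing [d]
    first is why [d] and [s] must differ. *)
Definition move (d s : nat) : com := Ins (NConst d 0) ;; Ins (NAdd d d s).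

Lemma wp_move (alpha : R) (E : list pt) (p M d s : nat) (Q : nat -> assertion)
  (w : nat) N Rg :
  d <> s -> (d < M)%nat -> (s < M)%nat -> (2 <= w)%nat ->
  Q (w - 2)%nat (updN N d (N s)) Rg -> wp alpha E p M (move d s) Q w N Rg.
Proof.
  intros Hd Hdm Hsm Hw HQ; unfold move; go.
  rewrite updN_updN, updN_eq, updN_neq by auto.
  replace (w - 1 - 1)%nat with (w - 2)%nat by lia; exact HQ.
Qed.

(** * Dispersion along the front *)

Lemma minl_le (l : list R) (x : R) : In x l -> minl l <= x.
Proof.
  assert (H : forall t y, fold_left Rmin t y <= y /\
            forall x, In x t -> fold_left Rmin t y <= x).
  { induction t as [|z t IH]; intros y; simpl; [split; [lra|easy]|].
    destruct (IH (Rmin y z)) as [H1 H2].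
    pose proof (Rmin_l y z); pose proof (Rmin_r y z).
    split; [lra|]. intros u [<-|Hu]; [lra|now apply H2]. }
  destruct l as [|y t]; [easy|]; simpl.
  destruct (H t y) as [H1 H2]; intros [<-|Hx]; auto.
Qed.

Lemma minl_in (l : list R) : l <> [] -> In (minl l) l.
Proof.
  assert (H : forall t y, In (fold_left Rmin t y) (y :: t)).
  { induction t as [|z t IH]; intros y; simpl; [now left|].
    destruct (IH (Rmin y z)) as [H|H]; [|now right; right].
    unfold Rmin in H at 1; destruct (Rle_dec y z); rewrite <- H; auto. }
  destruct l as [|y t]; [easy|]; intros _; apply H.
Qed.

Lemma minl_unique (l : list R) (v : R) :
  In v l -> (forall x, In x l -> v <= x) -> minl l = v.
Proof.
  intros Hv Hle; apply Rle_antisym; [now apply minl_le|].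
  apply Hle, minl_in; intros ->; easy.
Qed.

Lemma minl_ext (l l' : list R) : (forall x, In x l <-> In x l') -> minl l = minl l'.
Proof.
  intros H; destruct l as [|y t].
  - destruct l' as [|z t']; [reflexivity|]. destruct (H z) as [_ []]; now left.
  - symmetry; apply minl_unique.
    + apply H, minl_in; easy.
    + intros x Hx; apply minl_le, H, Hx.
Qed.

Lemma minl_map_mono (A : Type) (f g : A -> R) (l : list A) :
  (forall a, In a l -> f a <= g a) -> minl (map f l) <= minl (map g l).
Proof.
  intros H; destruct l as [|a t]; [simpl; lra|].
  assert (Hin : In (minl (map g (a :: t))) (map g (a :: t))) by (apply minl_in; easy).
  apply in_map_iff in Hin; destruct Hin as (b & <- & Hb).
  apply Rle_trans with (f b); [apply minl_le, in_map, Hb|now apply H].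
Qed.

Lemma sumR_perm (l l' : list R) : Permutation l l' -> sumR l = sumR l'.
Proof. induction 1; simpl; lra. Qed.

Lemma sumR_map_mono (A : Type) (f g : A -> R) (l : list A) :
  (forall a, In a l -> f a <= g a) -> sumR (map f l) <= sumR (map g l).
Proof.
  induction l as [|a l IH]; intros H; simpl; [lra|].
  apply Rplus_le_compat; [apply H; now left|apply IH; intros; apply H; now right].
Qed.

Lemma StronglySorted_map (A B : Type) (RA : A -> A -> Prop) (RB : B -> B -> Prop)
  (f : A -> B) (l : list A) :
  (forall a b, In a l -> In b l -> RA a b -> RB (f a) (f b)) ->
  StronglySorted RA l -> StronglySorted RB (map f l).
Proof.
  intros H Hs; induction Hs as [|a l Hs IH Hall]; simpl; constructor.
  - apply IH; intros; apply H; auto; now right.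
  - rewrite Forall_forall in *; intros b Hb.
    apply in_map_iff in Hb; destruct Hb as (c & <- & Hc).
    apply H; [now left|now right|auto].
Qed.

Lemma dpow_sym (alpha : R) (y z : pt) : dpow alpha y z = dpow alpha z y.
Proof.
  assert (H : edist y z = edist z y) by (unfold edist; f_equal; ring).
  unfold dpow; now rewrite H.
Qed.

Lemma dpow_nonneg (alpha : R) (y z : pt) : 0 <= dpow alpha y z.
Proof.
  unfold dpow; destruct (Req_EM_T (edist y z) 0); [lra|].
  unfold Rpower; left; apply exp_pos.
Qed.

(** The convention that the power vanishes at distance 0 keeps it monotone there; elsewhere [Rpower]
    is monotone in its base because [alpha > 0]. *)
Lemma dpow_mono (alpha : R) (y z y' z' : pt) :
  0 < alpha -> edist y z <= edist y' z' -> dpow alpha y z <= dpow alpha y' z'.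
Proof.
  intros Ha H.
  pose proof (dpow_nonneg alpha y' z') as H0.
  assert (Hp : 0 <= edist y z) by apply sqrt_pos.
  unfold dpow in *.
  destruct (Req_EM_T (edist y z) 0); [exact H0|].
  destruct (Req_EM_T (edist y' z') 0); [lra|].
  apply Rle_Rpower_l; lra.
Qed.

Section Dispersion.
Variables (alpha : R) (E : list pt).
Hypotheses (halpha : 0 < alpha) (hE : pareto_set E).

Definition xcoord (i : nat) : R := fst (getpt E i).
Definition gap (i j : nat) : R := dpow alpha (getpt E i) (getpt E j).
Definition in_front (l : list nat) : Prop := Forall (fun i => (i < length E)%nat) l.

Notation X := xcoord.
Notation D := gap.
Notation inE := in_front.

Lemma D_sym (i j : nat) : D i j = D j i.
Proof. apply dpow_sym. Qed.

Lemma D_nonneg (i j : nat) : 0 <= D i j.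
Proof. apply dpow_nonneg. Qed.

Lemma X_inj (i j : nat) : (i < length E)%nat -> (j < length E)%nat -> X i = X j -> i = j.
Proof.
  intros Hi Hj H; destruct (Nat.eq_dec i j) as [|Hij]; [easy|].
  unfold X in H; destruct (hE i j Hi Hj Hij) as [[H1 _]|[H1 _]]; lra.
Qed.

Lemma Y_anti (i j : nat) : (i < length E)%nat -> (j < length E)%nat ->
  X i <= X j -> snd (getpt E j) <= snd (getpt E i).
Proof.
  intros Hi Hj H; destruct (Nat.eq_dec i j) as [->|Hij]; [lra|].
  unfold X in H; destruct (hE i j Hi Hj Hij) as [[_ H1]|[H1 _]]; lra.
Qed.

Lemma D_mono (i j k l : nat) : inE [i; j; k; l] ->
  X i <= X j -> X j <= X k -> X k <= X l -> D j k <= D i l.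
Proof.
  intros H Hij Hjk Hkl; unfold inE in H; rewrite Forall_forall in H.
  assert (Hi : (i < length E)%nat) by (apply H; simpl; tauto).
  assert (Hj : (j < length E)%nat) by (apply H; simpl; tauto).
  assert (Hk : (k < length E)%nat) by (apply H; simpl; tauto).
  assert (Hl : (l < length E)%nat) by (apply H; simpl; tauto).
  pose proof (Y_anti i j Hi Hj Hij); pose proof (Y_anti j k Hj Hk Hjk);
    pose proof (Y_anti k l Hk Hl Hkl).
  apply dpow_mono; [exact halpha|]; unfold edist; apply sqrt_le_1_alt.
  unfold X in *; apply Rplus_le_compat; nra.
Qed.

(** The objective is indexed by positions in the selection. Indexing by points instead makes each
    contribution independent of the order of listing. *)
Definition nearest (sel : list nat) (a : nat) : R :=
  minl (map (D a) (filter (fun b => negb (Nat.eqb a b)) sel)).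

Lemma in_other_iff (sel : list nat) (a b : nat) :
  In b (filter (fun b => negb (Nat.eqb a b)) sel) <-> In b sel /\ b <> a.
Proof.
  rewrite filter_In, Bool.negb_true_iff, Nat.eqb_neq; firstorder.
Qed.

Lemma in_others_iff (q k l : nat) : In l (others q k) <-> (l < q)%nat /\ l <> k.
Proof.
  unfold others; rewrite filter_In, in_seq, Bool.negb_true_iff, Nat.eqb_neq.
  split; intros []; split; auto; lia.
Qed.

Lemma disp_value_nearest (sel : list nat) : NoDup sel ->
  disp_value alpha E sel = sumR (map (nearest sel) sel).
Proof.
  intros Hnd; unfold disp_value.
  assert (Hs : map (nearest sel) sel =
    map (fun k => nearest sel (nth k sel 0%nat)) (seq 0 (length sel))).
  { rewrite <- (map_map (fun k => nth k sel 0%nat) (nearest sel)); f_equal.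
    apply nth_ext with (d := 0%nat) (d' := nth 0 sel 0%nat);
      [now rewrite length_map, length_seq|].
    intros k Hk; rewrite (map_nth (fun k => nth k sel 0%nat)), seq_nth by exact Hk.
    reflexivity. }
  rewrite Hs; f_equal; apply map_ext_in; intros k Hk; apply in_seq in Hk.
  apply minl_ext; intros x; rewrite !in_map_iff; split.
  - intros (l & <- & Hl); apply in_others_iff in Hl; destruct Hl as [Hl Hlk].
    exists (nth l sel 0%nat); split; [reflexivity|]; apply in_other_iff; split.
    + now apply nth_In.
    + intros He; apply Hlk; apply (proj1 (NoDup_nth sel 0%nat) Hnd); auto; lia.
  - intros (b & <- & Hb); apply in_other_iff in Hb; destruct Hb as [Hb Hbk].
    apply (In_nth _ _ 0%nat) in Hb; destruct Hb as (l & Hl & <-).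
    exists l; split; [reflexivity|]; apply in_others_iff; split; [exact Hl|].
    intros ->; easy.
Qed.

Lemma disp_value_perm (sel sel' : list nat) : NoDup sel -> Permutation sel sel' ->
  disp_value alpha E sel = disp_value alpha E sel'.
Proof.
  intros Hnd Hp; rewrite !disp_value_nearest by (eauto using Permutation_NoDup).
  rewrite (sumR_perm _ _ (Permutation_map (nearest sel) Hp)); f_equal.
  apply map_ext; intros a; apply minl_ext; intros x; rewrite !in_map_iff.
  split; intros (b & <- & Hb); exists b; split; try reflexivity;
    apply in_other_iff in Hb; apply in_other_iff; split; try apply Hb.
  - apply (Permutation_in b Hp), Hb.
  - apply (Permutation_in b (Permutation_sym Hp)), Hb.
Qed.

(** Each summand is a minimum over the same positions on both sides, so it grows when all gaps grow.
    This is applied to the map pushing the extreme points outward. *)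
Lemma disp_value_mono (f : nat -> nat) (sel : list nat) : NoDup sel ->
  (forall a b, In a sel -> In b sel -> a <> b -> D a b <= D (f a) (f b)) ->
  disp_value alpha E sel <= disp_value alpha E (map f sel).
Proof.
  intros Hnd H; unfold disp_value; rewrite length_map.
  apply sumR_map_mono; intros k Hk; apply in_seq in Hk.
  apply minl_map_mono; intros l Hl; apply in_others_iff in Hl.
  rewrite !(nth_indep (map f sel) 0%nat (f 0%nat)) by (rewrite length_map; lia).
  rewrite !map_nth; apply H; try (apply nth_In; lia).
  intros He; apply (proj1 (NoDup_nth sel 0%nat) Hnd) in He; lia.
Qed.

(** Chains grow to the right, and the newest point is consed at the head. *)
Definition descending : list nat -> Prop := StronglySorted (fun a b => X b < X a).

Notation desc := descending.

Lemma desc_NoDup (L : list nat) : desc L -> NoDup L.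
Proof.
  induction 1 as [|a L Hs IH Hall]; constructor; auto.
  intros Ha; rewrite Forall_forall in Hall; specialize (Hall a Ha); lra.
Qed.

Lemma desc_insert (a : nat) (L : list nat) : (forall b, In b L -> X b <> X a) ->
  desc L -> exists L', Permutation (a :: L) L' /\ desc L'.
Proof.
  intros Ha Hs; induction Hs as [|b L Hs IH Hall].
  - exists [a]; split; [apply Permutation_refl|repeat constructor].
  - destruct (Rlt_le_dec (X b) (X a)) as [Hlt|Hle].
    + exists (a :: b :: L); split; [apply Permutation_refl|].
      constructor; [now constructor|]. constructor; [exact Hlt|].
      eapply Forall_impl; [|exact Hall]; simpl; intros; lra.
    + destruct IH as (L' & Hp & Hs'); [intros; apply Ha; now right|].
      exists (b :: L'); split.
      * apply perm_trans with (b :: a :: L); [apply perm_swap|now apply perm_skip].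
      * constructor; [exact Hs'|].
        assert (Hab : X b <> X a) by (apply Ha; now left).
        apply (Permutation_Forall Hp); constructor; [lra|exact Hall].
Qed.

Lemma desc_sort (L : list nat) : NoDup L -> inE L ->
  exists L', Permutation L L' /\ desc L'.
Proof.
  induction L as [|a L IH]; intros Hnd Hin.
  - exists []; split; constructor.
  - inversion_clear Hnd; inversion_clear Hin.
    destruct IH as (L1 & Hp & Hs); auto.
    destruct (desc_insert a L1) as (L2 & Hp2 & Hs2); auto.
    + intros b Hb Hx. apply H.
      apply (Permutation_in b (Permutation_sym Hp)) in Hb.
      replace a with b; [exact Hb|]. unfold inE in *; rewrite Forall_forall in *.
      apply X_inj; auto.
    + exists L2; split; [|exact Hs2].
      eapply perm_trans; [apply perm_skip, Hp|exact Hp2].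
Qed.

(* The contribution to the objective of all points but the head. *)
Fixpoint inner_sum (L : list nat) : R :=
  match L with
  | [] => 0
  | l :: t =>
    match t with
    | [] => 0
    | j :: r =>
      match r with
      | [] => D j l
      | i :: _ => inner_sum t + Rmin (D i j) (D j l)
      end
    end
  end.

Notation G := inner_sum.

Definition chain_value (L : list nat) : R :=
  match L with l :: j :: _ => G L + D j l | _ => 0 end.

Lemma G_nonneg (L : list nat) : 0 <= G L.
Proof.
  induction L as [|l [|j [|i r]] IH]; try (simpl; lra).
  - apply D_nonneg.
  - cbn [G]; cbn [G] in IH; apply Rplus_le_le_0_compat; [exact IH|].
    apply Rmin_glb; apply D_nonneg.
Qed.

Lemma nearest_unique (sel : list nat) (a b : nat) : In b sel -> b <> a ->
  (forall c, In c sel -> c <> a -> D a b <= D a c) -> nearest sel a = D a b.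
Proof.
  intros Hb Hba H; apply minl_unique.
  - apply in_map, in_other_iff; auto.
  - intros x Hx; apply in_map_iff in Hx; destruct Hx as (c & <- & Hc).
    apply in_other_iff in Hc; apply H; apply Hc.
Qed.

Lemma nearest_attained (sel : list nat) (a b : nat) : In b sel -> b <> a ->
  exists c, In c sel /\ c <> a /\ nearest sel a = D a c /\
    forall d, In d sel -> d <> a -> D a c <= D a d.
Proof.
  intros Hb Hba.
  assert (Hin : In (nearest sel a)
    (map (D a) (filter (fun b => negb (Nat.eqb a b)) sel))).
  { apply minl_in; intros He; apply map_eq_nil in He.
    assert (Hb' : In b (filter (fun b => negb (Nat.eqb a b)) sel))
      by (apply in_other_iff; auto).
    rewrite He in Hb'; easy. }
  apply in_map_iff in Hin; destruct Hin as (c & Hc & Hcin).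
  apply in_other_iff in Hcin; exists c; repeat split; try apply Hcin; [now symmetry|].
  intros d Hd Hda; rewrite Hc; apply minl_le, in_map, in_other_iff; auto.
Qed.

(** Adding a new rightmost point [l] to a chain with head [j] gives [l] the nearest point [j],
    replaces the contribution of [j] by a minimum of two gaps, and changes no other contribution. *)
Lemma desc_value (L : list nat) : desc L -> inE L ->
  (2 <= length L)%nat -> disp_value alpha E L = chain_value L.
Proof.
  intros Hs Hin Hlen; rewrite disp_value_nearest by now apply desc_NoDup.
  destruct L as [|l [|j r]]; simpl in Hlen; try lia; clear Hlen.
  revert l j Hs Hin; induction r as [|i r IH]; intros l j Hs Hin.
  - inversion_clear Hs as [|? ? _ H1]; inversion_clear H1 as [|? ? H2 _].
    cbn [map sumR fold_right chain_value G].
    rewrite (nearest_unique [l; j] l j), (nearest_unique [l; j] j l), (D_sym l j); simpl;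
      auto; try lra; try (intros ->; lra).
    + intros c [<-|[<-|[]]] Hc; [lra|easy].
    + intros c [<-|[<-|[]]] Hc; [easy|lra].
  - assert (Hs1 := Hs); inversion_clear Hs as [|? ? Hs2 H1].
    assert (Hs3 := Hs2); inversion_clear Hs2 as [|? ? Hs4 H2].
    assert (Hin1 := Hin); inversion_clear Hin as [|? ? Hl Hin2].
    specialize (IH j i Hs3 Hin2).
    inversion_clear Hs4 as [|? ? _ H3].
    unfold inE in Hin2; rewrite Forall_forall in H1, H2, H3, Hin2.
    assert (Hj : (j < length E)%nat) by (apply Hin2; simpl; tauto).
    assert (Hi : (i < length E)%nat) by (apply Hin2; simpl; tauto).
    assert (Hjl : X j < X l) by (apply H1; simpl; tauto).
    assert (Hij : X i < X j) by (apply H2; simpl; tauto).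
    assert (Hri : forall c, In c (i :: r) -> X c <= X i).
    { intros c [<-|Hc]; [lra|left; now apply H3]. }
    assert (Hbelow : forall c, In c (i :: r) -> D j i <= D j c).
    { intros c Hc; rewrite (D_sym j i), (D_sym j c); apply D_mono.
      - repeat constructor; auto; apply Hin2; now right.
      - now apply Hri.
      - lra.
      - lra. }
    assert (Nl : nearest (l :: j :: i :: r) l = D j l).
    { rewrite D_sym; apply nearest_unique; [simpl; tauto|intros ->; lra|].
      intros c [<-|Hc] Hcl; [easy|]; rewrite (D_sym l j), (D_sym l c); apply D_mono.
      - repeat constructor; auto.
      - destruct Hc as [<-|Hc]; [lra|left; now apply H2].
      - lra.
      - lra. }
    assert (Nj : nearest (j :: i :: r) j = D i j).
    { rewrite D_sym; apply nearest_unique; [simpl; tauto|intros ->; lra|].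
      intros c [<-|Hc] Hcl; [easy|]; now apply Hbelow. }
    assert (Nj' : nearest (l :: j :: i :: r) j = Rmin (D i j) (D j l)).
    { unfold Rmin; destruct (Rle_dec (D i j) (D j l)).
      - rewrite D_sym; apply nearest_unique; [simpl; tauto|intros ->; lra|].
        intros c [<-|[<-|Hc]] Hcl; [now rewrite D_sym|easy|]; now apply Hbelow.
      - apply nearest_unique; [simpl; tauto|intros ->; lra|].
        intros c [<-|[<-|Hc]] Hcl; [lra|easy|].
        specialize (Hbelow c Hc); rewrite (D_sym j i) in Hbelow; lra. }
    (* The new point [l] is at least as far from [a] as [j], which already competes for the
       minimum. *)
    assert (Na : forall a, In a (i :: r) ->
      nearest (l :: j :: i :: r) a = nearest (j :: i :: r) a).
    { intros a Ha.
      assert (Haj : X a < X j) by now apply H2.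
      destruct (nearest_attained (j :: i :: r) a j) as (c & Hc & Hca & -> & Hle);
        [simpl; tauto|intros ->; lra|].
      apply nearest_unique; [now right|exact Hca|].
      intros d [<-|Hd] Hda; [|now apply Hle].
      apply Rle_trans with (D a j); [apply Hle; [now left|intros ->; lra]|].
      apply D_mono; try lra.
      repeat constructor; auto; apply Hin2; now right. }
    cbn [map sumR fold_right] in IH |- *. fold sumR in IH |- *.
    cbn [chain_value] in IH |- *.
    change (G (l :: j :: i :: r)) with (G (j :: i :: r) + Rmin (D i j) (D j l)).
    rewrite Nl, Nj', Na by now left.
    rewrite (map_ext_in (nearest (l :: j :: i :: r)) (nearest (j :: i :: r)) r)
      by (intros; apply Na; now right).
    rewrite Nj in IH; unfold sumR in IH |- *; lra.
Qed.

(** Sorting a feasible selection preserves its value, so comparing sorted chains is enough. *)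
Lemma optimal_of_desc (p : nat) (L : list nat) : (2 <= p)%nat -> length L = p ->
  desc L -> inE L ->
  (forall L', length L' = p -> desc L' -> inE L' -> chain_value L' <= chain_value L) ->
  optimal alpha E p L /\ chain_value L = disp_value alpha E L.
Proof.
  intros Hp Hlen Hs Hin Hbest.
  assert (Hv : disp_value alpha E L = chain_value L) by (apply desc_value; auto; lia).
  split; [|now symmetry]; split.
  - repeat split; auto. now apply desc_NoDup.
  - intros sel (Hl & Hnd & Hi).
    destruct (desc_sort sel Hnd Hi) as (L' & Hperm & Hs').
    rewrite (disp_value_perm sel L' Hnd Hperm).
    assert (Hl' : length L' = p) by (rewrite <- (Permutation_length Hperm); auto).
    assert (Hi' : inE L') by (apply (Permutation_Forall Hperm); auto).
    rewrite desc_value, Hv by (auto; lia); now apply Hbest.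
Qed.

Lemma desc_extend (mn mx p : nat) (L : list nat) : (2 <= p)%nat -> length L = p ->
  desc L -> inE L -> inE [mn; mx] ->
  (forall i, (i < length E)%nat -> X mn <= X i <= X mx) ->
  exists mid, S (S (length mid)) = p /\ desc (mx :: mid ++ [mn]) /\
    inE (mx :: mid ++ [mn]) /\ chain_value L <= chain_value (mx :: mid ++ [mn]).
Proof.
  intros Hp Hlen Hs Hin Hm Hext.
  destruct L as [|m L1]; [simpl in Hlen; lia|].
  destruct (exists_last (l := L1)) as (mid & z & ->);
    [intros ->; simpl in Hlen; lia|].
  set (L := m :: mid ++ [z]) in *.
  (* [f] moves only the rightmost point [m] and the leftmost point [z]; it keeps the strict order
     and shrinks no gap. *)
  set (f := fun a => if Nat.eqb a m then mx else if Nat.eqb a z then mn else a).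
  assert (Hin' := Hin); unfold inE in Hin'; rewrite Forall_forall in Hin'.
  assert (Hinm := Hm); unfold inE in Hinm; rewrite Forall_forall in Hinm.
  assert (Htop : forall a, In a L -> a = m \/ X a < X m).
  { intros a [<-|Ha]; [now left|right]; inversion_clear Hs.
    rewrite Forall_forall in H0; now apply H0. }
  assert (Hbot : forall a, In a L -> a = z \/ X z < X a).
  { assert (Hg : forall l, desc (l ++ [z]) -> forall a, In a (l ++ [z]) ->
      a = z \/ X z < X a).
    { induction l as [|b l IH]; intros Hd a Ha.
      - destruct Ha as [<-|[]]; now left.
      - inversion_clear Hd; destruct Ha as [<-|Ha]; [right|now apply IH].
        rewrite Forall_forall in H0; apply H0, in_or_app; right; now left. }
    apply (Hg (m :: mid)); exact Hs. }
  assert (HmL : In m L) by now left.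
  assert (HzL : In z L) by (right; apply in_or_app; right; now left).
  assert (Hfin : forall a, In a L -> (f a < length E)%nat).
  { intros a Ha; unfold f; destruct (Nat.eqb a m); [apply Hinm; simpl; tauto|].
    destruct (Nat.eqb a z); [apply Hinm; simpl; tauto|now apply Hin']. }
  (* Having [b] on its left, [a] is not [z], the only point that [f] may move to the left. *)
  assert (Hup : forall a b, In a L -> In b L -> X b < X a -> X a <= X (f a)).
  { intros a b Ha Hb Hab; unfold f.
    destruct (Nat.eqb_spec a m); [apply Hext; auto|].
    destruct (Nat.eqb_spec a z) as [->|]; [|lra].
    destruct (Hbot b Hb) as [->|]; lra. }
  assert (Hdn : forall a b, In a L -> In b L -> X b < X a -> X (f b) <= X b).
  { intros a b Ha Hb Hab; unfold f.
    destruct (Nat.eqb_spec b m) as [->|].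
    { destruct (Htop a Ha) as [->|]; lra. }
    destruct (Nat.eqb_spec b z); [apply Hext; auto|lra]. }
  assert (Hzm : z <> m).
  { intros ->; apply desc_NoDup in Hs; inversion_clear Hs; apply H.
    apply in_or_app; right; now left. }
  assert (Hmap : map f L = mx :: mid ++ [mn]).
  { unfold L; simpl; rewrite map_app; simpl.
    replace (f m) with mx by (unfold f; now rewrite Nat.eqb_refl).
    replace (f z) with mn.
    2:{ unfold f; apply Nat.eqb_neq in Hzm; now rewrite Hzm, Nat.eqb_refl. }
    do 2 f_equal; rewrite <- map_id; apply map_ext_in; intros a Ha; unfold f.
    pose proof (desc_NoDup _ Hs) as Hnd; inversion_clear Hnd.
    apply NoDup_remove in H0; rewrite app_nil_r in H0.
    destruct (Nat.eqb_spec a m) as [->|]; [exfalso; apply H, in_or_app; now left|].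
    destruct (Nat.eqb_spec a z) as [->|]; [now destruct H0|reflexivity]. }
  assert (Hs' : desc (mx :: mid ++ [mn])).
  { rewrite <- Hmap; refine (StronglySorted_map _ _ _ _ f L _ Hs).
    intros a b Ha Hb Hab; specialize (Hup a b Ha Hb Hab);
      specialize (Hdn a b Ha Hb Hab); lra. }
  assert (Hi' : inE (mx :: mid ++ [mn])).
  { rewrite <- Hmap; apply Forall_map, Forall_forall; exact Hfin. }
  exists mid; split; [|split; [exact Hs'|split; [exact Hi'|]]].
  { unfold L in Hlen; simpl in Hlen; rewrite length_app in Hlen; simpl in Hlen; lia. }
  rewrite <- !desc_value; auto.
  2:{ simpl; rewrite length_app; simpl; lia. }
  2:{ lia. }
  rewrite <- Hmap; apply disp_value_mono; [now apply desc_NoDup|].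
  assert (Hlt : forall a b, In a L -> In b L -> X b < X a -> D b a <= D (f b) (f a)).
  { intros a b Ha Hb Hab; apply D_mono.
    - repeat constructor; auto.
    - now apply (Hdn a b).
    - lra.
    - now apply (Hup a b). }
  intros a b Ha Hb Hab.
  destruct (Rtotal_order (X a) (X b)) as [H|[H|H]].
  - now apply Hlt.
  - elim Hab; apply X_inj; auto.
  - rewrite (D_sym a b), (D_sym (f a)); now apply Hlt.
Qed.

End Dispersion.

(** * Enumeration for fixed [p] *)

Fixpoint moves (d : nat) (rs : list nat) : com :=
  match rs with
  | [] => Skip
  | r :: rs' => move d r ;; moves (S d) rs'
  end.

(* Fixed [p]: N[p+1] holds the number of points, N[p+2] a counter, N[p+3] the
   rightmost point; N[p+4], N[p+5], ... hold the current chain, from left to right.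
   R[10+2e] and R[11+2e] hold the value [G] and the last gap of the first [e+1]
   points of that chain. *)
Definition extend (p e : nat) (c : com) : com :=
  Ins (RLoadX 2 (p + 4 + e)) ;; Ins (RLoadX 3 (p + 5 + e)) ;;
  IfR 3 2 Skip (
    Ins (RDist (13 + 2 * e) (p + 4 + e) (p + 5 + e)) ;;
    IfR (11 + 2 * e) (13 + 2 * e)
      (Ins (RAdd (12 + 2 * e) (10 + 2 * e) (11 + 2 * e)))
      (Ins (RAdd (12 + 2 * e) (10 + 2 * e) (13 + 2 * e))) ;;
    c).

(** Listed from the newest point to the oldest, so that reading these registers yields a
    [descending] list. *)
Fixpoint chain_regs (p e : nat) : list nat :=
  (p + 4 + e)%nat :: match e with O => [] | S e' => chain_regs p e' end.

(** [k] interior points remain to be chosen; at [k = 0] the right end closes the chain. The left end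
    left in [N[p+4]] by [extremes] already is the first chain register. *)
Fixpoint nest (p k e : nat) : com :=
  match k with
  | O =>
      move (p + 5 + e) (p + 3) ;;
      extend p e (
        Ins (RAdd 4 (12 + 2 * e) (13 + 2 * e)) ;;
        IfR 4 0 Skip (Ins (RMove 0 4) ;; moves 1 (chain_regs p (S e))))
  | S k' =>
      Ins (NConst (p + 5 + e) 0) ;;
      For (p + 5 + e) (p + 1) (extend p e (nest p k' (S e)))
  end.

Definition extremes (p : nat) : com :=
  Ins (NSize (p + 1)) ;; Ins (NConst (p + 2) 0) ;;
  Ins (NConst (p + 3) 0) ;; Ins (NConst (p + 4) 0) ;;
  For (p + 2) (p + 1) (
    Ins (RLoadX 2 (p + 2)) ;; Ins (RLoadX 3 (p + 4)) ;; Ins (RLoadX 4 (p + 3)) ;;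
    IfR 3 2 Skip (move (p + 4) (p + 2)) ;;
    IfR 2 4 Skip (move (p + 3) (p + 2))).

(** Constants of the machine are natural numbers, so the mark -1 in [R[0]] is computed as
    [0 - 1]. *)
Definition fixed_prog (m : nat) : com :=
  let p := S (S m) in
  extremes p ;;
  Ins (RConst 1 1) ;; Ins (RConst 2 0) ;; Ins (RSub 0 2 1) ;;
  Ins (RConst 10 0) ;; Ins (RDist 11 (p + 4) (p + 3)) ;;
  nest p m 0.

(** * Correctness and cost of the nested loops *)

Section FixedSize.
Variables (alpha : R) (E : list pt).
Hypotheses (halpha : 0 < alpha) (hE : pareto_set E).
Variables (m p par M : nat).
Hypotheses (hp : p = (m + 2)%nat) (hM : (4 * p + 40 <= M)%nat).

Notation WP c A w N Rg := (wp alpha E par M c (fun _ => A) w N Rg).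
Notation X := (xcoord E).
Notation D := (gap alpha E).
Notation G := (inner_sum alpha E).
Notation desc := (descending E).
Notation inE := (in_front E).
Notation value := (chain_value alpha E).

(** All sources lie beyond the block of destinations, so no write destroys a value still to be
    read. *)
Lemma wp_moves (rs : list nat) : forall d N Rg,
  Forall (fun r => (d + length rs <= r < M)%nat) rs -> (d + length rs <= M)%nat ->
  WP (moves d rs) (fun N' R' => R' = Rg /\ map N' (seq d (length rs)) = map N rs /\
    forall r, (r < d \/ d + length rs <= r)%nat -> N' r = N r) (2 * length rs)%nat N Rg.
Proof.
  induction rs as [|r rs IH]; intros d N Rg Hrs HM; simpl moves.
  - apply wp_skip; repeat split; auto.
  - simpl length in *; inversion_clear Hrs as [|? ? Hr Hrs'].
    apply wp_seq, wp_move; try lia.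
    set (N1 := updN N d (N r)).
    eapply wp_call; [apply (IH (S d) N1 Rg)|lia|].
    + eapply Forall_impl; [|exact Hrs']; simpl; intros; lia.
    + lia.
    + intros N' R' (-> & Hmap & Hfr); split; [reflexivity|split].
      * simpl; rewrite Hmap, Hfr by lia; unfold N1 at 1; rewrite updN_eq; f_equal.
        apply map_ext_in; intros a Ha; rewrite Forall_forall in Hrs'.
        specialize (Hrs' a Ha); unfold N1; upd; reflexivity.
      * intros a Ha; rewrite Hfr by lia; unfold N1; upd; reflexivity.
Qed.

Lemma wp_extremes N Rg : (0 < length E)%nat ->
  WP (extremes p) (fun N' _ => N' (p + 1)%nat = length E /\
    (N' (p + 4) < length E)%nat /\ (N' (p + 3) < length E)%nat /\
    forall i, (i < length E)%nat -> X (N' (p + 4)%nat) <= X i <= X (N' (p + 3)%nat))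
    (length E * 20 + 5)%nat N Rg.
Proof.
  intros Hn; unfold extremes; go.
  pose (I := fun i (N' : nat -> nat) (R' : nat -> R) =>
    (N' (p + 2)%nat = i /\ N' (p + 1)%nat = length E) /\
    (N' (p + 4) < length E)%nat /\ (N' (p + 3) < length E)%nat /\
    forall j, (j < i)%nat -> X (N' (p + 4)%nat) <= X j <= X (N' (p + 3)%nat)).
  apply wp_for with (n := length E) (i0 := 0%nat) (I := I) (wb := 16%nat); try lia.
  - now intros i N' R' [H _].
  - repeat split; upd; try reflexivity; try exact Hn; lia.
  - clear N Rg; intros i N Rg Hi ((Hc & Hl) & Hmn & Hmx & Hext); go.
    apply wp_ifR; try lia; upd; intros Hle.
    + apply wp_skip; go; apply wp_ifR; try lia; upd; intros Hle2.
      * apply wp_skip; split; [exact Hc|]; unfold I; upd; repeat split; auto;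
          destruct (Nat.eq_dec j i) as [->|Hj]; try (apply Hext; lia);
          rewrite Hc in *; auto.
      * apply wp_move; try lia; upd; split; [exact Hc|]; unfold I; upd; rewrite Hc in *.
        repeat split; auto; try lia;
          destruct (Nat.eq_dec j i) as [->|Hj]; try lra; auto; try (apply Hext; lia).
        apply Rle_trans with (X (N (p + 3)%nat)); [apply Hext; lia|left; exact Hle2].
    + apply wp_move; try lia; apply wp_ifR; try lia; upd; intros Hle2.
      * apply wp_skip; upd; split; [exact Hc|]; unfold I; upd; rewrite Hc in *.
        repeat split; auto; try lia;
          destruct (Nat.eq_dec j i) as [->|Hj]; try lra; auto; try (apply Hext; lia).
        apply Rle_trans with (X (N (p + 4)%nat)); [left; exact Hle|apply Hext; lia].
      * apply wp_move; try lia; upd; split; [exact Hc|]; unfold I; upd; rewrite Hc in *.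
        repeat split; auto; try lia;
          destruct (Nat.eq_dec j i) as [->|Hj]; try lra.
        -- apply Rle_trans with (X (N (p + 4)%nat)); [left; exact Hle|apply Hext; lia].
        -- apply Rle_trans with (X (N (p + 3)%nat)); [apply Hext; lia|left; exact Hle2].
  - intros N' R' ((_ & Hl) & Hmn & Hmx & Hext); auto.
Qed.

Variables (mn mx : nat).
Hypotheses (hmn : (mn < length E)%nat) (hmx : (mx < length E)%nat).
Hypothesis hext : forall i, (i < length E)%nat -> X mn <= X i <= X mx.

Definition last_gap (c : list nat) : R :=
  match c with l :: j :: _ => D j l | _ => D mn mx end.

Lemma D_le_extremes (i j : nat) : (i < length E)%nat -> (j < length E)%nat ->
  X i <= X j -> D i j <= D mn mx.
Proof.
  intros Hi Hj Hij; apply (D_mono alpha E halpha hE); auto.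
  - repeat constructor; auto.
  - now apply hext.
  - now apply hext.
Qed.

(* The gap D(mn,mx) dominates all others, so it can stand for the missing left
   neighbour of a one-point chain. *)
Lemma G_cons (j i : nat) (c : list nat) : desc (j :: i :: c) -> inE (j :: i :: c) ->
  G (j :: i :: c) = G (i :: c) + Rmin (last_gap (i :: c)) (D i j).
Proof.
  intros Hs Hin; destruct c as [|h c]; [|reflexivity].
  cbn [inner_sum last_gap]; rewrite Rmin_right; [ring|].
  unfold in_front in Hin; rewrite Forall_forall in Hin.
  inversion_clear Hs as [|? ? _ H]; inversion_clear H.
  apply D_le_extremes; [apply Hin; simpl; tauto|apply Hin; simpl; tauto|lra].
Qed.

Definition chain (e : nat) (c : list nat) : assertion := fun N Rg =>
  c = map N (chain_regs p e) /\ desc c /\ inE c /\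
  Rg (10 + 2 * e)%nat = G c /\ Rg (11 + 2 * e)%nat = last_gap c.

Lemma chain_regs_range (e : nat) :
  Forall (fun r => (p + 4 <= r <= p + 4 + e)%nat) (chain_regs p e).
Proof.
  induction e; simpl; constructor; try lia; [constructor|].
  eapply Forall_impl; [|exact IHe]; simpl; intros; lia.
Qed.

Lemma length_chain_regs (e : nat) : length (chain_regs p e) = S e.
Proof. induction e; simpl in *; lia. Qed.

Lemma desc_cons (j i : nat) (c : list nat) :
  X i < X j -> desc (i :: c) -> desc (j :: i :: c).
Proof.
  intros Hij Hs; constructor; [exact Hs|]; constructor; [exact Hij|].
  inversion_clear Hs; eapply Forall_impl; [|exact H0]; simpl; intros; lra.
Qed.

(** Before [b] starts, only the real registers 2, 3, [12+2e] and [13+2e] are written, so the data of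
    all shorter chains survive for the enclosing loops. *)
Lemma wp_extend (e : nat) (c : list nat) (b : com) (T : nat) (A : assertion) N Rg :
  (e <= m)%nat ->
  chain e c N Rg -> (N (p + 5 + e) < length E)%nat ->
  (desc (N (p + 5 + e)%nat :: c) -> forall R', chain (S e) (N (p + 5 + e)%nat :: c) N R' ->
     (forall r, (r = 0 \/ 10 <= r < 12 + 2 * e)%nat -> R' r = Rg r) -> WP b A T N R') ->
  (~ desc (N (p + 5 + e)%nat :: c) -> forall R',
     (forall r, (r = 0 \/ 10 <= r < 12 + 2 * e)%nat -> R' r = Rg r) -> A N R') ->
  WP (extend p e b) A (T + 10)%nat N Rg.
Proof.
  intros He (Hc & Hs & Hin & HG & HD) Hj H1 H2; unfold extend; go.
  set (j := N (p + 5 + e)%nat) in *.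
  assert (Hce : exists c', c = N (p + 4 + e)%nat :: c').
  { rewrite Hc; destruct e; simpl; eexists; reflexivity. }
  destruct Hce as (c' & Hce); set (i := N (p + 4 + e)%nat) in *.
  apply wp_ifR; try lia; upd; intros Hij.
  - apply wp_skip, H2.
    + rewrite Hce; intros Hd; inversion_clear Hd; inversion_clear H0; unfold xcoord in *; lra.
    + intros r Hr; upd; reflexivity.
  - change (X i < X j) in Hij.
    assert (Hd : desc (j :: c)) by (rewrite Hce in *; now apply desc_cons).
    assert (Hin' : inE (j :: c)) by now constructor.
    assert (HG' : G (j :: c) = G c + Rmin (last_gap c) (D i j)).
    { rewrite Hce in *; now apply G_cons. }
    go; fold i j; change (dpow alpha (getpt E i) (getpt E j)) with (D i j).
    apply wp_ifR; try lia; upd; intros Hle; go;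
      (eapply wp_call; [apply H1; [exact Hd| |]|lia|intros N' R' HA; exact HA]).
    + replace (p + 5 + e)%nat with (p + 4 + S e)%nat in j by lia.
      repeat split; auto.
      * unfold j; simpl; f_equal; [f_equal; lia|exact Hc].
      * upd. replace (10 + 2 * S e)%nat with (12 + 2 * e)%nat by lia; upd.
        rewrite HG', HG, HD, Rmin_left; [reflexivity|now rewrite <- HD].
      * replace (11 + 2 * S e)%nat with (13 + 2 * e)%nat by lia; upd.
        rewrite Hce; reflexivity.
    + intros r Hr; upd; reflexivity.
    + repeat split; auto.
      * unfold j; simpl; f_equal; [f_equal; lia|exact Hc].
      * replace (10 + 2 * S e)%nat with (12 + 2 * e)%nat by lia; upd.
        rewrite HG', HG, Rmin_right; [reflexivity|rewrite <- HD; lra].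
      * replace (11 + 2 * S e)%nat with (13 + 2 * e)%nat by lia; upd.
        rewrite Hce; reflexivity.
    + intros r Hr; upd; reflexivity.
Qed.

(** [V] is the set of complete chains accounted for so far; loops only enlarge it. *)
Definition best (V : list nat -> Prop) : assertion := fun N Rg =>
  (forall L, V L -> value L <= Rg 0%nat) /\
  (Rg 0%nat = -1 \/ (Rg 0%nat = value (map N (seq 1 p)) /\
     desc (map N (seq 1 p)) /\ inE (map N (seq 1 p)))).

Definition above (k : nat) (c L : list nat) : Prop :=
  exists mid, length mid = k /\ L = mx :: mid ++ c /\ desc L /\ inE L.

Definition frame (e : nat) (N N' : nat -> nat) (Rg R' : nat -> R) : Prop :=
  (forall r, (p < r <= p + 4 + e)%nat -> N' r = N r) /\
  (forall r, (10 <= r < 12 + 2 * e)%nat -> R' r = Rg r).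

Lemma best_ext (V V' : list nat -> Prop) N Rg N' R' : best V N Rg ->
  (forall L, V' L -> V L) -> R' 0%nat = Rg 0%nat ->
  (forall r, (1 <= r <= p)%nat -> N' r = N r) -> best V' N' R'.
Proof.
  intros [H1 H2] HV HR HN; unfold best; rewrite HR.
  replace (map N' (seq 1 p)) with (map N (seq 1 p)).
  - split; auto.
  - apply map_ext_in; intros r Hr; apply in_seq in Hr; symmetry; apply HN; lia.
Qed.

(** The 14 is 10 for [extend] plus 4 for the loop; the 2 is the reset of the counter and the final
    test. *)
Fixpoint nest_cost (k : nat) : nat :=
  match k with
  | O => 2 * p + 20
  | S k' => length E * (nest_cost k' + 14) + 2
  end.

Lemma wp_nest (k : nat) : forall e c V N Rg, (k + e)%nat = m ->
  N (p + 1)%nat = length E -> N (p + 3)%nat = mx ->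
  chain e c N Rg -> best V N Rg ->
  WP (nest p k e) (fun N' R' => frame e N N' Rg R' /\
    best (fun L => V L \/ above k c L) N' R') (nest_cost k) N Rg.
Proof.
  induction k as [|k IH]; intros e c V N Rg Hke Hn Hmx Hc Hb; cbn [nest nest_cost].
  - apply wp_seq, wp_move; try lia; upd.
    set (N1 := updN N (p + 5 + e) (N (p + 3)%nat)).
    assert (HN1 : forall r, r <> (p + 5 + e)%nat -> N1 r = N r).
    { intros r Hr; unfold N1; upd; reflexivity. }
    assert (Hj : N1 (p + 5 + e)%nat = mx) by (unfold N1; upd; exact Hmx).
    replace (2 * p + 20 - 2)%nat with ((2 * p + 8) + 10)%nat by lia.
    apply wp_extend with (c := c); rewrite ?Hj; [lia| |exact hmx| |].
    + destruct Hc as (Hc & Hc2); split; [|exact Hc2].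
      rewrite Hc; apply map_ext_in; intros r Hr; symmetry; apply HN1.
      pose proof (chain_regs_range e) as Hcr; rewrite Forall_forall in Hcr.
      specialize (Hcr r Hr); lia.
    + intros Hd R' (Hmap & _ & Hin & HG & HD) HR; go.
      assert (Habove : forall L, above 0 c L -> L = mx :: c).
      { intros L (mid & Hmid & -> & _); now destruct mid. }
      assert (Hcv : value (mx :: c) = R' (12 + 2 * e)%nat + R' (13 + 2 * e)%nat).
      { replace (12 + 2 * e)%nat with (10 + 2 * S e)%nat by lia.
        replace (13 + 2 * e)%nat with (11 + 2 * S e)%nat by lia.
        rewrite HG, HD. destruct c as [|l c]; [|reflexivity].
        destruct Hc as (Hc & _); destruct e; discriminate. }
      rewrite <- Hcv; apply wp_ifR; try lia; upd; intros Hle.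
      * apply wp_skip; split.
        { split; intros r Hr; upd; [apply HN1; lia|apply HR; lia]. }
        rewrite HR in Hle by lia.
        assert (Hb' : best (fun L => V L \/ above 0 c L) N Rg).
        { destruct Hb as [Hb1 Hb2]; split; [|exact Hb2].
          intros L [HL|HL]; [now apply Hb1|]. rewrite (Habove L HL); exact Hle. }
        apply (best_ext _ _ _ _ _ _ Hb'); auto.
        -- upd; apply HR; lia.
        -- intros r Hr; apply HN1; lia.
      * apply wp_seq; ins; eapply wp_call; [apply wp_moves| |].
        -- rewrite length_chain_regs; eapply Forall_impl; [|apply chain_regs_range].
           simpl; intros; lia.
        -- rewrite length_chain_regs; lia.
        -- rewrite length_chain_regs; lia.
        -- rewrite length_chain_regs; intros N' R2 (-> & Hm & Hfr).
           rewrite HR in Hle by lia.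
           (* With [k = 0] we have [e = m], so the closed chain has [m + 2 = p] points and fills
              exactly the output registers. *)
           rewrite <- Hmap in Hm; replace (S (S e)) with p in * by lia.
           split.
           ++ split; intros r Hr; upd; [rewrite Hfr by lia; apply HN1; lia|apply HR; lia].
           ++ split; upd.
              ** intros L [HL|HL]; [|rewrite (Habove L HL); lra].
                 destruct Hb as [Hb1 _]; specialize (Hb1 L HL); lra.
              ** right; rewrite Hm; auto.
    + intros Hd R' HR; split.
      { split; intros r Hr; [apply HN1; lia|apply HR; lia]. }
      apply (best_ext _ _ _ _ _ _ Hb).
      * intros L [HL|(mid & Hmid & -> & Hs & _)]; [exact HL|].
        destruct mid; [now elim Hd|easy].
      * apply HR; lia.
      * intros r Hr; apply HN1; lia.
  - go.
    set (N0 := updN N (p + 5 + e) 0).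
    assert (HN0 : forall r, r <> (p + 5 + e)%nat -> N0 r = N r).
    { intros r Hr; unfold N0; upd; reflexivity. }
    pose (I := fun i N' R' => (frame e N N' Rg R' /\ N' (p + 5 + e)%nat = i) /\
      best (fun L => V L \/ exists j, (j < i)%nat /\ above k (j :: c) L) N' R').
    apply wp_for with (n := length E) (i0 := 0%nat) (I := I)
      (wb := (nest_cost k + 10)%nat); try lia.
    + intros i N' R' [[[Hf _] Hi] _]; split; [exact Hi|].
      rewrite Hf by lia; exact Hn.
    + repeat split.
      * intros r Hr; apply HN0; lia.
      * unfold N0; upd; reflexivity.
      * intros L [HL|(j & Hj & _)]; [now apply Hb|lia].
      * replace (map N0 (seq 1 p)) with (map N (seq 1 p)); [apply Hb|].
        apply map_ext_in; intros r Hr; apply in_seq in Hr; symmetry; apply HN0; lia.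
    + intros i N1 R1 Hi [[[HfN HfR] HNi] Hb1].
      apply wp_extend with (c := c); rewrite ?HNi; [lia| |lia| |].
      * destruct Hc as (Hc & Hd & Hin & HG & HD).
        repeat split; auto; try (rewrite HfR by lia; assumption).
        rewrite Hc; apply map_ext_in; intros r Hr; symmetry; apply HfN.
        pose proof (chain_regs_range e) as Hcr; rewrite Forall_forall in Hcr.
        specialize (Hcr r Hr); lia.
      * intros Hd R2 Hc2 HR2.
        eapply wp_call; [apply (IH (S e) (i :: c)
          (fun L => V L \/ exists j, (j < i)%nat /\ above k (j :: c) L) N1 R2)| |].
        -- lia.
        -- rewrite HfN by lia; exact Hn.
        -- rewrite HfN by lia; exact Hmx.
        -- exact Hc2.
        -- apply (best_ext _ _ _ _ _ _ Hb1); [|apply HR2; lia|auto].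
           intros L HL; exact HL.
        -- lia.
        -- intros N3 R3 [[HfN3 HfR3] Hb3].
           assert (HNi3 : N3 (p + 5 + e)%nat = i) by (rewrite HfN3 by lia; exact HNi).
           split; [exact HNi3|]. split; [split; [split|]|].
           ++ intros r Hr; upd; rewrite HfN3 by lia; now apply HfN.
           ++ intros r Hr; rewrite HfR3, HR2 by lia; now apply HfR.
           ++ upd; reflexivity.
           ++ apply (best_ext _ _ _ _ _ _ Hb3); [|reflexivity|intros r Hr; upd; reflexivity].
              intros L [HL|(j & Hj & HL)]; [left; now left|].
              destruct (Nat.eq_dec j i) as [->|Hji]; [now right|].
              left; right; exists j; split; [lia|exact HL].
      * intros Hd R2 HR2; split; [reflexivity|]. split; [split; [split|]|].
        -- intros r Hr; upd; now apply HfN.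
        -- intros r Hr; rewrite HR2 by lia; now apply HfR.
        -- upd; reflexivity.
        -- apply (best_ext _ _ _ _ _ _ Hb1); [|apply HR2; lia|intros r Hr; upd; reflexivity].
           intros L [HL|(j & Hj & HL)]; [now left|].
           destruct (Nat.eq_dec j i) as [->|Hji].
           (* A skipped point loses nothing: any chain through it would have [i :: c] as a suffix,
              and suffixes of descending chains are descending. *)
           { destruct HL as (mid & _ & -> & HL & _); elim Hd.
             change (mx :: mid ++ i :: c) with ((mx :: mid) ++ i :: c) in HL.
             revert HL; generalize (mx :: mid); clear; intros l.
             induction l as [|a l IHl]; [easy|]; intros HL; inversion_clear HL; auto. }
           right; exists j; split; [lia|exact HL].
    + intros N' R' [[Hf _] Hb']; split; [exact Hf|].
      apply (best_ext _ _ _ _ _ _ Hb'); auto.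
      intros L [HL|(mid & Hmid & -> & Hs & Hin)]; [now left|right].
      (* The last interior point is the neighbour of [c], that is, the index tried by this loop. *)
      destruct (exists_last (l := mid)) as (mid' & j & ->); [intros ->; discriminate|].
      exists j; split.
      * unfold in_front in Hin; rewrite Forall_forall in Hin; apply Hin.
        right; apply in_or_app; left; apply in_or_app; right; now left.
      * exists mid'; rewrite length_app in Hmid; simpl in Hmid.
        rewrite <- app_assoc in *; repeat split; auto; lia.
Qed.

Lemma best_optimal N Rg : (p <= length E)%nat ->
  best (fun L => above m [mn] L) N Rg ->
  optimal alpha E p (map N (seq 1 p)) /\
  Rg 0%nat = disp_value alpha E (map N (seq 1 p)).
Proof.
  intros Hpn [Hall Hatt].
  assert (Hmm : inE [mn; mx]) by (repeat constructor; auto).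
  assert (Hub : forall L, length L = p -> desc L -> inE L -> value L <= Rg 0%nat).
  { intros L Hlen Hs Hin.
    destruct (desc_extend alpha E halpha hE mn mx p L) as (mid & Hmid & Hs' & Hin' & Hle);
      auto; [lia|].
    eapply Rle_trans; [exact Hle|]; apply Hall; exists mid; repeat split; auto; lia. }
  destruct Hatt as [Hneg|(Hv & Hs & Hin)].
  (* As [p <= length E], sorting the first [p] points gives a chain of nonnegative value, so -1
     cannot have survived. *)
  - exfalso; destruct (desc_sort E hE (seq 0 p)) as (L & Hperm & Hs).
    + apply seq_NoDup.
    + apply Forall_forall; intros i Hi; apply in_seq in Hi; lia.
    + assert (Hge : 0 <= value L).
      { unfold chain_value; destruct L as [|l [|j L]]; try lra.
        apply Rplus_le_le_0_compat; [apply G_nonneg|apply D_nonneg]. }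
      assert (Hle : value L <= Rg 0%nat); [|lra].
      apply Hub; [|exact Hs|].
      * rewrite <- (Permutation_length Hperm); apply length_seq.
      * apply (Permutation_Forall Hperm), Forall_forall; intros i Hi.
        apply in_seq in Hi; lia.
  - rewrite Hv; apply optimal_of_desc; auto; [lia|now rewrite length_map, length_seq|].
    intros L H1 H2 H3; rewrite <- Hv; now apply Hub.
Qed.

End FixedSize.

Lemma wp_fixed_prog (alpha : R) (E : list pt) (m M : nat) N Rg :
  0 < alpha -> pareto_set E -> (S (S m) <= length E)%nat -> (4 * S (S m) + 40 <= M)%nat ->
  wp alpha E (S (S m)) M (fixed_prog m)
    (fun _ N' R' => optimal alpha E (S (S m)) (map N' (seq 1 (S (S m)))) /\
       R' 0%nat = disp_value alpha E (map N' (seq 1 (S (S m)))))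
    (length E * 20 + 10 + nest_cost E (S (S m)) m)%nat N Rg.
Proof.
  intros Ha HE Hn HM; unfold fixed_prog; cbv zeta.
  remember (S (S m)) as p eqn:Hp; assert (hp : p = (m + 2)%nat) by lia; clear Hp.
  apply wp_seq; eapply wp_call; [eapply wp_extremes with (m := m); eauto; lia|lia|].
  clear N Rg; intros N Rg (Hl & Hmn & Hmx & Hext); go.
  eapply wp_call.
  - apply (wp_nest alpha E Ha HE m p p M hp HM (N (p + 4)%nat) (N (p + 3)%nat) Hmn Hmx Hext m 0
      [N (p + 4)%nat] (fun _ => False)); auto.
    + split; [simpl; now rewrite Nat.add_0_r|].
      split; [repeat constructor|]; split; [repeat constructor; exact Hmn|].
      simpl; upd; split; reflexivity.
    + split; [easy|]; left; upd; simpl; lra.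
  - lia.
  - intros N' R' [_ Hb].
    eapply best_optimal with (m := m) (mn := N (p + 4)%nat) (mx := N (p + 3)%nat); eauto.
    destruct Hb as [Hb1 Hb2]; split; [|exact Hb2]; intros L HL; apply Hb1; now right.
Qed.

Lemma nest_cost_bound (p k : nat) : exists C, forall E : list pt,
  (1 <= length E)%nat -> (nest_cost E p k <= C * length E ^ k)%nat.
Proof.
  induction k as [|k [C HC]].
  - exists (2 * p + 20)%nat; intros E HE; simpl; lia.
  - exists (C + 16)%nat; intros E HE; specialize (HC E HE); cbn [nest_cost].
    set (n := length E) in *.
    assert (Hpow : (1 <= n ^ k)%nat) by (apply Nat.neq_0_lt_0, Nat.pow_nonzero; lia).
    rewrite Nat.pow_succ_r'; nia.
Qed.

(** [m] nested loops cost [n^m], but the search for the two ends is linear even for [m = 0]; hence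
    the exponent [max 1 m]. *)
Lemma fixed_solvable (alpha : R) (m : nat) : 0 < alpha ->
  exists (P : list instr) (C : nat), forall E : list pt,
    (S (S m) <= length E)%nat -> pareto_set E ->
    solves_within alpha P E (S (S m)) (C * length E ^ Nat.max 1 m) C.
Proof.
  intros Ha; destruct (nest_cost_bound (S (S m)) m) as (C & HC).
  (* The summand [4m + 100] covers both the [4p + 40 = 4m + 48] registers and the linear scan. *)
  exists (compile (fixed_prog m) 0 ++ [Halt]), (C + 4 * m + 100)%nat; intros E Hn HE.
  apply wp_solves; eapply wp_call; [apply wp_fixed_prog; auto; lia| |auto].
  specialize (HC E ltac:(lia)); set (n := length E) in *.
  assert (H1 : (n ^ 1 <= n ^ Nat.max 1 m)%nat) by (apply Nat.pow_le_mono_r; lia).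
  assert (H2 : (n ^ m <= n ^ Nat.max 1 m)%nat) by (apply Nat.pow_le_mono_r; lia).
  rewrite Nat.pow_1_r in H1; nia.
Qed.

(** * Dynamic programming *)

(* Only the [i] with [g i >= 0] compete; (-1, 0) means that there are none. *)
Fixpoint argmax (g f : nat -> R) (k : nat) : R * nat :=
  match k with
  | O => (-1, 0%nat)
  | S i =>
    let a := argmax g f i in
    if Rle_dec 0 (g i) then if Rle_dec (f i) (fst a) then a else (f i, i) else a
  end.

Lemma argmax_ub (g f : nat -> R) (k i : nat) :
  (i < k)%nat -> 0 <= g i -> f i <= fst (argmax g f k).
Proof.
  intros Hi Hg; induction k as [|k IH]; [lia|]; simpl.
  destruct (Nat.eq_dec i k) as [->|Hik].
  - destruct (Rle_dec 0 (g k)); [|easy].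
    destruct (Rle_dec (f k) (fst (argmax g f k))); simpl; lra.
  - specialize (IH ltac:(lia)).
    destruct (Rle_dec 0 (g k)); [|easy].
    destruct (Rle_dec (f k) (fst (argmax g f k))); simpl; lra.
Qed.

Lemma argmax_attained (g f : nat -> R) (k : nat) :
  argmax g f k = (-1, 0%nat) \/
  exists i, (i < k)%nat /\ 0 <= g i /\ argmax g f k = (f i, i).
Proof.
  induction k as [|k IH]; [now left|]; simpl.
  assert (IH' : argmax g f k = (-1, 0%nat) \/
    exists i, (i < S k)%nat /\ 0 <= g i /\ argmax g f k = (f i, i)).
  { destruct IH as [IH|(i & Hi & IH)]; [now left|right; exists i; split; [lia|exact IH]]. }
  destruct (Rle_dec 0 (g k)); [|exact IH'].
  destruct (Rle_dec (f k) (fst (argmax g f k))); [exact IH'|].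
  right; exists k; repeat split; auto.
Qed.

(** * The table of optimal chains *)

Section Recurrence.
Variables (alpha : R) (E : list pt).
Hypotheses (halpha : 0 < alpha) (hE : pareto_set E).

Notation X := (xcoord E).
Notation D := (gap alpha E).
Notation G := (inner_sum alpha E).
Notation desc := (descending E).
Notation inE := (in_front E).
Notation value := (chain_value alpha E).

(* [table t j l]: the best [G L] among chains [L = l :: j :: _] of [t+1] points
   (negative if there are none), with the third point of an optimal one. At
   [t = 0] the value 0 for all [j], [l] makes the recurrence yield
   [max_i min(D i j, D j l) = D j l] at [t = 1], the maximum being reached at [i = l]. *)
Fixpoint table (t j l : nat) : R * nat :=
  match t with
  | O => (0, 0%nat)
  | S t' =>
    if Rle_dec (X l) (X j) then (-1, 0%nat)
    else argmax (fun i => fst (table t' i j))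
           (fun i => fst (table t' i j) + Rmin (D i j) (D j l)) (length E)
  end.

Fixpoint trace (t j l : nat) : list nat :=
  match t with
  | O => [l]
  | S t' => l :: trace t' (snd (table t j l)) j
  end.

(** The default index 0 is in range too, so tracing back always forms valid table addresses. *)
Lemma table_snd_lt (t j l : nat) : (0 < length E)%nat -> (snd (table t j l) < length E)%nat.
Proof.
  intros Hn; destruct t as [|t]; [exact Hn|]; cbn [table].
  destruct (Rle_dec (X l) (X j)); [exact Hn|].
  match goal with |- context [argmax ?g ?f ?k] =>
    destruct (argmax_attained g f k) as [->|(i & Hi & _ & ->)] end; auto.
Qed.

Lemma table_1 (j l : nat) : (l < length E)%nat -> X j < X l -> fst (table 1 j l) = D j l.
Proof.
  intros Hl Hjl; cbn [table]; destruct (Rle_dec (X l) (X j)); [lra|].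
  cbn [fst].
  match goal with |- context [argmax ?g ?f ?k] =>
    pose proof (argmax_ub g f k l Hl) as Hub;
    destruct (argmax_attained g f k) as [H|(i & Hi & _ & H)] end;
    rewrite H in *; cbn [fst] in *;
    rewrite (D_sym alpha E l j), Rmin_left in Hub by lra.
  - pose proof (D_nonneg alpha E j l); lra.
  - pose proof (Rmin_r (D i j) (D j l)); lra.
Qed.

(** A nonnegative entry is not the default -1, so its stored index attains the maximum; that index
    competed only because its own entry is nonnegative, which feeds the induction. *)
Lemma table_sound (t : nat) : forall j l, (j < length E)%nat -> (l < length E)%nat ->
  0 <= fst (table (S t) j l) ->
  let L := trace (S t) j l in
  desc L /\ inE L /\ length L = S (S t) /\ G L = fst (table (S t) j l) /\
  exists r, L = l :: j :: r.
Proof.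
  induction t as [|t IH]; intros j l Hj Hl H0 L.
  - assert (Hjl : X j < X l).
    { cbn [table] in H0; destruct (Rle_dec (X l) (X j)); simpl in H0; lra. }
    rewrite table_1 by assumption; subst L; cbn [trace].
    repeat split; [|repeat constructor; auto|now exists []].
    repeat constructor; exact Hjl.
  - subst L; change (trace (S (S t)) j l) with (l :: trace (S t) (snd (table (S (S t)) j l)) j).
    remember (S t) as t1 eqn:Ht1; cbn [table] in H0 |- *; subst t1.
    destruct (Rle_dec (X l) (X j)) as [|Hjl]; [simpl in H0; lra|].
    apply Rnot_le_lt in Hjl.
    match goal with |- context [argmax ?g ?f ?k] =>
      destruct (argmax_attained g f k) as [H|(i & Hi & Hg & H)] end;
      rewrite H in *; cbn [fst snd] in *; [lra|].
    destruct (IH i j Hi Hj Hg) as (Hs & Hin & Hlen & HG & r & Hr).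
    rewrite Hr in *; repeat split.
    + now apply desc_cons.
    + now constructor.
    + simpl in *; lia.
    + rewrite <- HG; reflexivity.
    + eexists; reflexivity.
Qed.

(** The third point of the chain is one of the candidates of [argmax]. It competes only if its entry
    is nonnegative, so both claims are carried through the induction together. *)
Lemma table_complete (r : list nat) : forall j l, desc (l :: j :: r) ->
  inE (l :: j :: r) -> 0 <= fst (table (S (length r)) j l) /\
    G (l :: j :: r) <= fst (table (S (length r)) j l).
Proof.
  induction r as [|i r IH]; intros j l Hs Hin.
  - inversion_clear Hs; inversion_clear H0; inversion_clear Hin.
    rewrite table_1 by assumption; split; [apply D_nonneg|apply Rle_refl].
  - assert (Hs' := Hs); inversion_clear Hs' as [|? ? Hs1 H1]; inversion_clear H1.
    assert (Hin' := Hin); inversion_clear Hin' as [|? ? Hl Hin1].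
    destruct (IH i j) with (2 := Hin1) as [IH1 IH2]; auto.
    change (length (i :: r)) with (S (length r)).
    remember (S (length r)) as t; cbn [table].
    destruct (Rle_dec (X l) (X j)); [lra|].
    assert (Hi : (i < length E)%nat) by (inversion_clear Hin1; inversion_clear H2; auto).
    match goal with |- context [argmax ?g ?f ?k] =>
      pose proof (argmax_ub g f k i Hi) as Hub; cbv beta in Hub end.
    set (a := argmax _ _ _) in *.
    change (G (l :: j :: i :: r)) with (G (j :: i :: r) + Rmin (D i j) (D j l)).
    pose proof (G_nonneg alpha E (j :: i :: r)).
    assert (0 <= Rmin (D i j) (D j l)) by (apply Rmin_glb; apply D_nonneg).
    assert (Hi0 : 0 <= fst (table t i j)) by lra.
    specialize (Hub Hi0); lra.
Qed.

End Recurrence.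


(* Dynamic programming: N[1..6] = n, p, table address A, level t, j, l; N[11] = B.
   Level [t], entry [(j,l)] is stored at A + (t n + j) n + l in both register files;
   the selection is first written to N[B+1..B+p], as N[1..p] is in use. *)
Definition address (a b c : nat) : com :=
  Ins (NMul 9 a 1) ;; Ins (NAdd 9 9 b) ;; Ins (NMul 9 9 1) ;;
  Ins (NAdd 9 9 c) ;; Ins (NAdd 9 9 3).

Definition dp_init : com :=
  Ins (NSize 1) ;; Ins (NParam 2) ;; Ins (NConst 11 15) ;; Ins (NAdd 11 11 2) ;;
  Ins (NConst 3 10) ;; Ins (NAdd 3 3 11) ;; Ins (NAdd 3 3 11) ;;
  Ins (RConst 5 0) ;; Ins (NConst 4 0) ;; Ins (NConst 12 1) ;; Ins (NSub 12 2 12).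

Definition dp_inner : com :=
  address 4 7 5 ;; Ins (RLoad 3 9) ;;
  IfR 5 3
    (Ins (RDist 4 7 5) ;;
     IfR 4 2 (Ins (RAdd 6 3 4)) (Ins (RAdd 6 3 2)) ;;
     IfR 6 1 Skip (Ins (RMove 1 6) ;; move 8 7))
    Skip.

Definition dp_cell : com :=
  Ins (RDist 2 5 6) ;; Ins (RConst 1 1) ;; Ins (RSub 1 5 1) ;; Ins (NConst 8 0) ;;
  Ins (RLoadX 3 5) ;; Ins (RLoadX 4 6) ;;
  IfR 4 3 Skip (Ins (NConst 7 0) ;; For 7 1 dp_inner) ;;
  Ins (NConst 10 1) ;; Ins (NAdd 10 4 10) ;; address 10 5 6 ;;
  Ins (RStore 9 1) ;; Ins (NStore 9 8).

(** Round [t] writes level [t + 1], so the bound [N[12] = p - 1] reaches the level of chains of [p]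
    points, and [N[4]] exits pointing at it. *)
Definition dp_fill : com :=
  For 4 12 (Ins (NConst 5 0) ;; For 5 1 (Ins (NConst 6 0) ;; For 6 1 dp_cell)).

Definition dp_final : com :=
  Ins (RConst 1 1) ;; Ins (RSub 0 5 1) ;; Ins (NConst 8 0) ;; Ins (NConst 13 0) ;;
  Ins (NConst 5 0) ;; For 5 1 (Ins (NConst 6 0) ;; For 6 1 (
    address 4 5 6 ;; Ins (RLoad 3 9) ;;
    IfR 5 3
      (Ins (RDist 2 5 6) ;; Ins (RAdd 6 3 2) ;;
       IfR 6 0 Skip (Ins (RMove 0 6) ;; move 8 5 ;; move 13 6))
      Skip)) ;;
  move 5 8 ;; move 6 13.

Definition dp_trace : com :=
  Ins (NConst 10 1) ;; Ins (NAdd 10 2 10) ;; Ins (NConst 12 1) ;;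
  For 12 10 (
    Ins (NAdd 9 11 12) ;; Ins (NStore 9 6) ;; address 4 5 6 ;; Ins (NLoad 8 9) ;;
    move 6 5 ;; move 5 8 ;; Ins (NConst 0 1) ;; Ins (NSub 4 4 0)).

Definition dp_copy : com :=
  Ins (NConst 12 1) ;;
  For 12 10 (
    Ins (NConst 8 15) ;; Ins (NAdd 8 8 12) ;; Ins (NAdd 9 11 8) ;;
    Ins (NLoad 9 9) ;; Ins (NStore 8 9)).

Fixpoint fetch (k : nat) : com :=
  match k with
  | O => Skip
  | S k' => fetch k' ;; Ins (NConst k k) ;; Ins (NAdd k k 0) ;; Ins (NLoad k k)
  end.

Definition dp_prog : com :=
  dp_init ;; dp_fill ;; dp_final ;; dp_trace ;; dp_copy ;; move 0 11 ;; fetch 15.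

Lemma map_add_seq (a s k : nat) : map (Nat.add a) (seq s k) = seq (a + s) k.
Proof.
  revert s; induction k as [|k IH]; intros s; simpl; [reflexivity|].
  now rewrite IH, Nat.add_succ_r.
Qed.

(** * Correctness and cost of the dynamic program *)

Section Program.
Variables (alpha : R) (E : list pt).
Hypotheses (halpha : 0 < alpha) (hE : pareto_set E).
Variables (n p : nat).
Hypotheses (hn : length E = n) (hp : (2 <= p <= n)%nat).

Notation M := (2 * p + 50 + p * n * n)%nat.
Notation WP c A w N Rg := (wp alpha E p M c (fun _ => A) w N Rg).
Notation X := (xcoord E).
Notation D := (gap alpha E).
Notation G := (inner_sum alpha E).
Notation desc := (descending E).
Notation inE := (in_front E).
Notation value := (chain_value alpha E).
Notation U t j l := (fst (table alpha E t j l)).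
Notation arg t j l := (snd (table alpha E t j l)).

Definition addr (t j l : nat) : nat := ((t * n + j) * n + l + (2 * p + 40))%nat.

Lemma addr_lt (t j l : nat) : (t < p)%nat -> (j < n)%nat -> (l < n)%nat ->
  (2 * p + 40 <= addr t j l < M)%nat.
Proof.
  intros Ht Hj Hl; unfold addr.
  assert (t * n + j < p * n)%nat by nia.
  assert ((t * n + j) * n + l < p * n * n)%nat by nia. lia.
Qed.

(** Up to the offset, [j] and [l] are the two lowest digits of the address in base [n]. *)
Lemma addr_inj (t j l t' j' l' : nat) : (j < n)%nat -> (l < n)%nat ->
  (j' < n)%nat -> (l' < n)%nat -> addr t j l = addr t' j' l' ->
  t = t' /\ j = j' /\ l = l'.
Proof.
  assert (Hinj : forall a b a' b', (b < n)%nat -> (b' < n)%nat ->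
    (a * n + b = a' * n + b')%nat -> a = a' /\ b = b').
  { intros a b a' b' Hb Hb' H.
    assert (a = a') by (destruct (Nat.lt_trichotomy a a') as [|[|]]; nia).
    subst; lia. }
  intros Hj Hl Hj' Hl' H; unfold addr in H.
  destruct (Hinj (t * n + j)%nat l (t' * n + j')%nat l') as [H1 ->]; auto; [lia|].
  destruct (Hinj t j t' j') as [-> ->]; auto.
Qed.

(** [vis] singles out the entries already filled in. *)
Definition tab (vis : nat -> nat -> nat -> Prop) : assertion := fun N Rg =>
  forall t j l, (t < p)%nat -> (j < n)%nat -> (l < n)%nat -> vis t j l ->
    Rg (addr t j l) = U t j l /\ N (addr t j l) = arg t j l.

Lemma tab_ext (vis vis' : nat -> nat -> nat -> Prop) N Rg N' R' :
  tab vis N Rg -> (forall t j l, (j < n)%nat -> (l < n)%nat -> vis' t j l -> vis t j l) ->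
  (forall r, (2 * p + 40 <= r)%nat -> N' r = N r /\ R' r = Rg r) -> tab vis' N' R'.
Proof.
  intros H Hv Heq t j l Ht Hj Hl Hvis; destruct (addr_lt t j l Ht Hj Hl) as [Ha _].
  destruct (Heq _ Ha) as [-> ->]; auto.
Qed.

Definition core : assertion := fun N Rg =>
  N 1%nat = n /\ N 2%nat = p /\ N 3%nat = (2 * p + 40)%nat /\
  N 11%nat = (p + 15)%nat /\ Rg 5%nat = 0.

Lemma wp_address (a b c : nat) (Q : nat -> assertion) (w : nat) N Rg :
  (a < 16)%nat -> (b < 16)%nat -> (c < 16)%nat -> b <> 9%nat -> c <> 9%nat ->
  N 1%nat = n -> N 3%nat = (2 * p + 40)%nat -> (5 <= w)%nat ->
  Q (w - 5)%nat (updN N 9 (addr (N a) (N b) (N c))) Rg ->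
  wp alpha E p M (address a b c) Q w N Rg.
Proof.
  intros Ha Hb Hc Hb9 Hc9 H1 H3 Hw HQ; unfold address; go.
  rewrite !updN_updN; upd; rewrite H1, H3; fold (addr (N a) (N b) (N c)).
  replace (w - 1 - 1 - 1 - 1 - 1)%nat with (w - 5)%nat by lia; exact HQ.
Qed.

Lemma wp_inner (t j l : nat) N Rg : (S t < p)%nat -> (j < n)%nat -> (l < n)%nat ->
  core N Rg -> tab (fun t' _ _ => t' = t) N Rg ->
  N 4%nat = t -> N 5%nat = j -> Rg 2%nat = D j l ->
  N 7%nat = 0%nat -> Rg 1%nat = -1 -> N 8%nat = 0%nat ->
  let a := argmax (fun i => U t i j) (fun i => U t i j + Rmin (D i j) (D j l)) n in
  WP (For 7 1 dp_inner) (fun N' R' => R' 1%nat = fst a /\ N' 8%nat = snd a /\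
    (forall r, (1 <= r <= 6 \/ 10 <= r)%nat -> N' r = N r) /\
    (forall r, (r = 0 \/ r = 2 \/ r = 5 \/ 7 <= r)%nat -> R' r = Rg r))
    (n * 24 + 1)%nat N Rg.
Proof.
  intros Ht Hj Hl (H1 & H2 & H3 & H11 & R5) Htab H4 H5 HR2 H7 HR1 H8; cbv zeta.
  set (g := fun i => U t i j).
  set (f := fun i => U t i j + Rmin (D i j) (D j l)).
  pose (I := fun i (N' : nat -> nat) (R' : nat -> R) => N' 7%nat = i /\
    R' 1%nat = fst (argmax g f i) /\ N' 8%nat = snd (argmax g f i) /\
    (forall r, (1 <= r <= 6 \/ 10 <= r)%nat -> N' r = N r) /\
    (forall r, (r = 0 \/ r = 2 \/ r = 5 \/ 7 <= r)%nat -> R' r = Rg r)).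
  apply wp_for with (n := n) (i0 := 0%nat) (I := I) (wb := 20%nat); try lia.
  - intros i N' R' (Hi & _ & _ & HN & _); split; [exact Hi|]; now rewrite HN by lia.
  - repeat split; auto.
  - intros i N1 R1 Hi (Hi7 & Hm & Ha & HfN & HfR); unfold dp_inner.
    destruct (addr_lt t i j) as [Hlo Hhi]; try lia.
    destruct (Htab t i j) as [Hval _]; try lia; try reflexivity.
    apply wp_seq, wp_address; try lia; try (rewrite HfN by lia; assumption).
    rewrite Hi7, !HfN, H4, H5 by lia.
    go; upd; try lia.
    rewrite (HfR (addr t i j)), Hval by lia.
    apply wp_ifR; try lia; upd; rewrite (HfR 5%nat), R5 by lia; intros Hg.
    + go; upd; rewrite Hi7, (HfN 5%nat), H5 by lia.
      change (dpow alpha (getpt E i) (getpt E j)) with (D i j).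
      (* Both outcomes of the comparison computing [Rmin] continue with this test, which is treated
         once for any real registers holding the candidate value. *)
      assert (Hcand : forall Rc, Rc 6%nat = f i ->
        (forall r, r <> 6%nat -> r <> 3%nat -> r <> 4%nat -> Rc r = R1 r) ->
        forall w, (5 <= w)%nat ->
        wp alpha E p M (IfR 6 1 Skip (Ins (RMove 1 6) ;; move 8 7))
          (fun _ N' R' => N' 7%nat = i /\ I (S i) (updN (updN N' 0 1) 7 (S i)) R')
          w (updN N1 9 (addr t i j)) Rc).
      { intros Rc Hc HRc w Hw.
        assert (Harg : argmax g f (S i) =
          if Rle_dec (f i) (fst (argmax g f i)) then argmax g f i else (f i, i)).
        { cbn [argmax]; destruct (Rle_dec 0 (g i)) as [|Hng]; [reflexivity|].
          unfold g in Hng; lra. }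
        apply wp_ifR; try lia; rewrite Hc, (HRc 1%nat), Hm by lia; intros Hle.
        - apply wp_skip; upd; split; [exact Hi7|]. unfold I; rewrite Harg.
          destruct (Rle_dec (f i) (fst (argmax g f i))) as [Hd|Hd]; [|lra].
          upd; repeat split; auto.
          + rewrite HRc by lia; exact Hm.
          + intros r Hr; upd; auto.
          + intros r Hr; rewrite HRc by lia; auto.
        - apply wp_seq; ins; apply wp_move; try lia; upd; split; [exact Hi7|].
          unfold I; rewrite Harg.
          destruct (Rle_dec (f i) (fst (argmax g f i))) as [Hd|Hd]; [lra|].
          upd; repeat split; auto.
          + intros r Hr; upd; auto.
          + intros r Hr; upd; rewrite HRc by lia; auto. }
      apply wp_ifR; try lia; upd; rewrite (HfR 2%nat), HR2 by lia; intros Hle;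
        ins; (apply Hcand; [|intros r Hr1 Hr2 Hr3; upd; reflexivity|lia]).
      * upd; unfold f; now rewrite Rmin_left.
      * upd; rewrite (HfR 2%nat), HR2 by lia; unfold f; rewrite Rmin_right; [reflexivity|lra].
    + apply wp_skip; upd; split; [exact Hi7|].
      assert (Harg : argmax g f (S i) = argmax g f i).
      { cbn [argmax]; destruct (Rle_dec 0 (g i)) as [Hng|]; [|reflexivity].
        unfold g in Hng; lra. }
      unfold I; rewrite Harg; upd; repeat split; auto; intros r Hr; upd; auto.
  - intros N' R' (_ & Hm & Ha & HfN & HfR); auto.
Qed.

Definition cell_cost : nat := n * 24 + 40.

Lemma wp_cell (t j l : nat) vis N Rg : (S t < p)%nat -> (j < n)%nat -> (l < n)%nat ->
  core N Rg -> tab vis N Rg -> (forall j' l', vis t j' l') ->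
  N 4%nat = t -> N 5%nat = j -> N 6%nat = l ->
  WP dp_cell (fun N' R' => core N' R' /\
    tab (fun t' j' l' => vis t' j' l' \/ (t' = S t /\ j' = j /\ l' = l)) N' R' /\
    (forall r, (1 <= r <= 6 \/ 11 <= r <= 13)%nat -> N' r = N r)) cell_cost N Rg.
Proof.
  intros Ht Hj Hl (H1 & H2 & H3 & H11 & R5) Htab Hvis H4 H5 H6.
  unfold dp_cell, cell_cost; go; rewrite H5, H6.
  assert (Hstore : forall N1 R1 w, R1 1%nat = U (S t) j l -> N1 8%nat = arg (S t) j l ->
    (forall r, (1 <= r <= 6 \/ 10 <= r)%nat -> N1 r = N r) ->
    (forall r, (r = 5 \/ 7 <= r)%nat -> R1 r = Rg r) -> (10 <= w)%nat ->
    wp alpha E p M (Ins (NConst 10 1) ;; Ins (NAdd 10 4 10) ;; address 10 5 6 ;;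
      Ins (RStore 9 1) ;; Ins (NStore 9 8)) (fun _ N' R' => core N' R' /\
    tab (fun t' j' l' => vis t' j' l' \/ (t' = S t /\ j' = j /\ l' = l)) N' R' /\
    (forall r, (1 <= r <= 6 \/ 11 <= r <= 13)%nat -> N' r = N r)) w N1 R1).
  { intros N1 R1 w Hm Ha HN HR Hw.
    destruct (addr_lt (S t) j l) as [Hlo Hhi]; try lia.
    apply wp_seq; ins; apply wp_seq; ins; rewrite updN_updN; upd.
    apply wp_seq, wp_address; try lia; upd; try (rewrite HN by lia; assumption).
    rewrite !HN, H4, H5, H6, Nat.add_1_r by lia.
    go; upd; try lia.
    split; [|split].
    - unfold core; upd; repeat split; try (rewrite HN by lia; assumption).
      rewrite HR by lia; exact R5.
    - intros t' j' l' Ht' Hj' Hl' Hv.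
      destruct (addr_lt t' j' l' Ht' Hj' Hl') as [Hlo' Hhi'].
      (* By injectivity of [addr], the store changes no entry other than [(S t, j, l)]. *)
      destruct (Nat.eq_dec (addr t' j' l') (addr (S t) j l)) as [He|Hne].
      + apply addr_inj in He; try lia; destruct He as (-> & -> & ->); upd; auto.
      + upd; rewrite HN, HR by lia; apply Htab; auto.
        destruct Hv as [Hv|(-> & -> & ->)]; [exact Hv|easy].
    - intros r Hr; upd; apply HN; lia. }
  assert (Htable : table alpha E (S t) j l =
    if Rle_dec (X l) (X j) then (-1, 0%nat)
    else argmax (fun i => U t i j) (fun i => U t i j + Rmin (D i j) (D j l)) n)
    by (rewrite <- hn; reflexivity).
  apply wp_ifR; try lia; upd; rewrite ?H5, ?H6; intros Hle.
  - change (X l <= X j) in Hle; destruct (Rle_dec (X l) (X j)) as [Hd|Hd]; [|lra].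
    apply wp_skip, Hstore; try lia; rewrite ?Htable; upd.
    + rewrite R5; simpl; ring.
    + reflexivity.
    + intros r Hr; upd; reflexivity.
    + intros r Hr; upd; reflexivity.
  - change (X j < X l) in Hle; destruct (Rle_dec (X l) (X j)) as [Hd|Hd]; [lra|].
    apply wp_seq; ins.
    eapply wp_call; [apply (wp_inner t j l)|lia|]; auto; upd; auto.
    + unfold core; upd; repeat split; assumption.
    + apply (tab_ext _ _ _ _ _ _ Htab); [intros t' j' l' _ _ ->; apply Hvis|].
      intros r Hr; upd; split; reflexivity.
    + rewrite R5; simpl; ring.
    + intros N1 R1 (Hm & Ha & HN & HR); apply Hstore; try lia; rewrite ?Htable; auto.
      * intros r Hr; rewrite HN by lia; upd; reflexivity.
      * intros r Hr; rewrite HR by lia; upd; reflexivity.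
Qed.

Definition fill_cost : nat := p * (n * (n * (cell_cost + 4) + 6) + 6) + 1.

Lemma wp_fill N Rg : core N Rg -> tab (fun t _ _ => t = 0%nat) N Rg ->
  N 4%nat = 0%nat -> N 12%nat = (p - 1)%nat ->
  WP dp_fill (fun N' R' => core N' R' /\ tab (fun _ _ _ => True) N' R' /\
    N' 4%nat = (p - 1)%nat) fill_cost N Rg.
Proof.
  intros Hcore Htab H4 H12; unfold dp_fill, fill_cost.
  (* The three invariants fill the table lexicographically: full levels up to [t], then the rows of
     level [t + 1] before [j], then the entries of row [j] before [l]. *)
  pose (I := fun t (N' : nat -> nat) (R' : nat -> R) =>
    core N' R' /\ N' 4%nat = t /\ N' 12%nat = (p - 1)%nat /\
    tab (fun t' _ _ => (t' <= t)%nat) N' R').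
  pose (J := fun t j (N' : nat -> nat) (R' : nat -> R) =>
    core N' R' /\ N' 4%nat = t /\ N' 12%nat = (p - 1)%nat /\ N' 5%nat = j /\
    tab (fun t' j' _ => (t' <= t \/ t' = S t /\ j' < j)%nat) N' R').
  pose (K := fun t j l (N' : nat -> nat) (R' : nat -> R) =>
    core N' R' /\ N' 4%nat = t /\ N' 12%nat = (p - 1)%nat /\ N' 5%nat = j /\
    N' 6%nat = l /\ tab (fun t' j' l' =>
      (t' <= t \/ t' = S t /\ (j' < j \/ j' = j /\ l' < l))%nat) N' R').
  assert (Hcore_upd : forall N1 R1 a b, core N1 R1 -> (4 <= a <= 6)%nat ->
    core (updN (updN N1 0 1) a b) R1).
  { intros N1 R1 a b (H1 & H2 & H3 & H11 & R5) Ha; unfold core; upd; auto. }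
  assert (Hcore_upd1 : forall N1 R1 a b, core N1 R1 -> (4 <= a <= 6)%nat ->
    core (updN N1 a b) R1).
  { intros N1 R1 a b (H1 & H2 & H3 & H11 & R5) Ha; unfold core; upd; auto. }
  apply wp_for with (n := (p - 1)%nat) (i0 := 0%nat) (I := I)
    (wb := (n * (n * (cell_cost + 4) + 6) + 2)%nat); try lia.
  - intros t N' R' (_ & H4' & H12' & _); auto.
  - refine (conj Hcore (conj H4 (conj H12 _))).
    apply (tab_ext _ _ _ _ _ _ Htab); auto; lia.
  - clear N Rg Hcore Htab H4 H12; intros t N Rg Ht (Hcore & H4 & H12 & Htab).
    apply wp_seq; ins.
    apply wp_for with (n := n) (i0 := 0%nat) (I := J t)
      (wb := (n * (cell_cost + 4) + 2)%nat); try lia.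
    + intros j N' R' (Hc & _ & _ & H5 & _); split; [exact H5|apply Hc].
    + unfold J; upd; refine (conj _ (conj H4 (conj H12 (conj eq_refl _)))); [apply Hcore_upd1; auto; lia|].
      apply (tab_ext _ _ _ _ _ _ Htab); [intros; lia|].
      intros r Hr; upd; auto.
    + clear N Rg Hcore H4 H12 Htab; intros j N Rg Hj (Hcore & H4 & H12 & H5 & Htab).
      apply wp_seq; ins.
      apply wp_for with (n := n) (i0 := 0%nat) (I := K t j) (wb := cell_cost); try lia.
      * intros l N' R' (Hc & _ & _ & _ & H6 & _); split; [exact H6|apply Hc].
      * unfold K; upd; refine (conj _ (conj H4 (conj H12 (conj H5 (conj eq_refl _)))));
          [apply Hcore_upd1; auto; lia|].
        apply (tab_ext _ _ _ _ _ _ Htab); [intros; lia|].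
        intros r Hr; upd; auto.
      * clear N Rg Hcore H4 H12 H5 Htab;
          intros l N Rg Hl (Hcore & H4 & H12 & H5 & H6 & Htab).
        eapply wp_call; [apply (wp_cell t j l) with (2 := proj2 Hj) (3 := proj2 Hl)
          (4 := Hcore) (5 := Htab)|lia|]; auto; try lia.
        intros N' R' (Hcore' & Htab' & HN); rewrite HN, H6 by lia; split; [reflexivity|].
        unfold K; upd; rewrite !HN by lia;
          refine (conj _ (conj H4 (conj H12 (conj H5 (conj eq_refl _)))));
          [apply Hcore_upd; auto; lia|].
        apply (tab_ext _ _ _ _ _ _ Htab'); [intros; lia|].
        intros r Hr; upd; auto.
      * intros N' R' (Hcore' & H4' & H12' & H5' & _ & Htab'); split; [exact H5'|].
        unfold J; upd; refine (conj _ (conj H4' (conj H12' (conj eq_refl _)))); [apply Hcore_upd; auto; lia|].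
        apply (tab_ext _ _ _ _ _ _ Htab'); [intros; lia|].
        intros r Hr; upd; auto.
    + intros N' R' (Hcore' & H4' & H12' & _ & Htab'); split; [exact H4'|].
      unfold I; upd; refine (conj _ (conj eq_refl (conj H12' _))); [apply Hcore_upd; auto; lia|].
      apply (tab_ext _ _ _ _ _ _ Htab'); [intros; lia|].
      intros r Hr; upd; auto.
  - intros N' R' (Hc & H4' & _ & Htab'); refine (conj Hc (conj _ H4')).
    intros t j l Ht Hj Hl _; apply Htab'; auto; lia.
Qed.


Definition final_cost : nat := n * (n * 30 + 6) + 20.

Lemma wp_final N Rg : core N Rg -> tab (fun _ _ _ => True) N Rg ->
  N 4%nat = (p - 1)%nat ->
  WP dp_final (fun N' R' => core N' R' /\ tab (fun _ _ _ => True) N' R' /\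
    N' 4%nat = (p - 1)%nat /\ (N' 5 < n)%nat /\ (N' 6 < n)%nat /\
    0 <= U (p - 1) (N' 5%nat) (N' 6%nat) /\
    R' 0%nat = U (p - 1) (N' 5%nat) (N' 6%nat) + D (N' 5%nat) (N' 6%nat) /\
    forall L, length L = p -> desc L -> inE L -> value L <= R' 0%nat) final_cost N Rg.
Proof.
  intros (H1 & H2 & H3 & H11 & R5) Htab H4; unfold dp_final, final_cost.
  set (T := (p - 1)%nat) in *.
  assert (HT : (T < p)%nat) by (unfold T; lia).
  (* The best pair is kept in [N[8]] and [N[13]], as [N[5]] and [N[6]] are the counters of the
     scan. *)
  pose (J := fun (vis : nat -> nat -> Prop) (N' : nat -> nat) (R' : nat -> R) =>
    (forall r, (1 <= r <= 4 \/ r = 11 \/ 2 * p + 40 <= r)%nat -> N' r = N r) /\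
    (forall r, (r = 5 \/ 2 * p + 40 <= r)%nat -> R' r = Rg r) /\
    (forall j l, (j < n)%nat -> (l < n)%nat -> vis j l -> 0 <= U T j l ->
       U T j l + D j l <= R' 0%nat) /\
    (R' 0%nat = -1 \/ (N' 8 < n)%nat /\ (N' 13 < n)%nat /\ 0 <= U T (N' 8%nat) (N' 13%nat) /\
       R' 0%nat = U T (N' 8%nat) (N' 13%nat) + D (N' 8%nat) (N' 13%nat))).
  assert (HJ : forall (vis vis' : nat -> nat -> Prop) N1 R1 a b, J vis N1 R1 ->
    (forall j l, (j < n)%nat -> (l < n)%nat -> vis' j l -> vis j l) ->
    (a = 5 \/ a = 6)%nat -> J vis' (updN N1 a b) R1 /\ J vis' (updN (updN N1 0 1) a b) R1).
  { intros vis vis' N1 R1 a b (HN & HR & Hub & Hat) Hv Ha.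
    split; (split; [intros r Hr; upd; now apply HN|]); (split; [exact HR|]);
      (split; [intros j l Hj Hl Hvis; apply Hub; auto|]); upd; exact Hat. }
  do 5 (apply wp_seq; ins).
  apply wp_seq; eapply wp_call.
  - apply wp_for with (n := n) (i0 := 0%nat) (wb := (n * 30 + 2)%nat)
      (w := (n * (n * 30 + 6) + 1)%nat)
      (I := fun j N' R' => N' 5%nat = j /\ J (fun j' _ => (j' < j)%nat) N' R'); try lia.
    + intros j N' R' (H5 & HN & _); split; [exact H5|]; now rewrite HN by lia.
    + split; [upd; reflexivity|].
      split; [intros r Hr; upd; reflexivity|].
      split; [intros r Hr; upd; reflexivity|].
      split; [intros; lia|]; left; upd; rewrite R5; simpl; ring.
    + intros j N1 R1 Hj (H5 & HJ1); apply wp_seq; ins.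
      apply wp_for with (n := n) (i0 := 0%nat) (wb := 26%nat)
        (I := fun l N' R' => N' 6%nat = l /\ N' 5%nat = j /\
          J (fun j' l' => j' < j \/ j' = j /\ l' < l)%nat N' R'); try lia.
      * intros l N' R' (H6 & _ & HN & _); split; [exact H6|]; now rewrite HN by lia.
      * split; [upd; reflexivity|]; split; [upd; exact H5|].
        refine (proj1 (HJ _ _ N1 R1 6%nat 0%nat HJ1 _ _)); [cbv beta; intros; lia|now right].
      * clear N1 R1 H5 HJ1; intros l N1 R1 Hl (H6 & H5 & HJ1).
        destruct HJ1 as (HN & HR & Hub & Hat).
        destruct (addr_lt T j l) as [Hlo Hhi]; try lia.
        destruct (Htab T j l) as [Hval _]; try lia; auto.
        apply wp_seq, wp_address; try lia; try (rewrite HN by lia; assumption).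
        rewrite H5, H6, HN, H4 by lia.
        go; upd; try lia.
        rewrite (HR (addr T j l)), Hval by lia.
        assert (Hkeep : forall R2, (0 <= U T j l -> U T j l + D j l <= R1 0%nat) ->
          (forall r, (r = 0 \/ r = 5 \/ 2 * p + 40 <= r)%nat -> R2 r = R1 r) ->
          J (fun j' l' => j' < j \/ j' = j /\ l' < S l)%nat
            (updN (updN (updN N1 9 (addr T j l)) 0 1) 6 (S l)) R2).
        { intros R2 Hjl HR2; split; [intros r Hr; upd; now apply HN|].
          split; [intros r Hr; rewrite HR2 by lia; now apply HR|].
          rewrite HR2 by lia; split; [|upd; exact Hat].
          intros j' l' Hj' Hl' Hv; destruct (Nat.eq_dec j' j) as [->|Hjj].
          - destruct (Nat.eq_dec l' l) as [->|Hll]; [exact Hjl|apply Hub; auto; lia].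
          - apply Hub; auto; lia. }
        apply wp_ifR; try lia; upd; rewrite (HR 5%nat), R5 by lia; intros Hpos.
        -- go; upd; rewrite H5, H6.
           change (dpow alpha (getpt E j) (getpt E l)) with (D j l).
           apply wp_ifR; try lia; upd; intros Hle.
           ++ apply wp_skip; upd; split; [exact H6|]; split; [reflexivity|].
              split; [exact H5|].
              apply Hkeep; [intros _; exact Hle|intros r Hr; upd; reflexivity].
           ++ apply wp_seq; ins; apply wp_seq, wp_move; try lia; apply wp_move; try lia.
              upd; split; [exact H6|]; split; [reflexivity|]; split; [exact H5|].
              rewrite H5, H6; split; [intros r Hr; upd; now apply HN|].
              split; [intros r Hr; upd; now apply HR|]; upd; split.
              ** intros j' l' Hj' Hl' Hv; destruct (Nat.eq_dec j' j) as [->|Hjj].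
                 { destruct (Nat.eq_dec l' l) as [->|Hll]; [lra|].
                   intros H0; apply Rle_trans with (R1 0%nat); [apply Hub; auto; lia|lra]. }
                 intros H0; apply Rle_trans with (R1 0%nat); [apply Hub; auto; lia|lra].
              ** right; repeat split; auto; lia.
        -- apply wp_skip; upd; split; [exact H6|]; split; [reflexivity|].
           split; [exact H5|].
           apply Hkeep; [lra|intros r Hr; upd; reflexivity].
      * intros N' R' (_ & H5' & HJ'); split; [exact H5'|]; split; [upd; reflexivity|].
        refine (proj2 (HJ _ _ N' R' 5%nat (S j) HJ' _ _)); [cbv beta; intros; lia|now left].
    + intros N' R' HI; exact HI.
  - lia.
  - intros N1 R1 (_ & HN & HR & Hub & Hat).
    apply wp_seq, wp_move; try lia; apply wp_move; try lia; upd.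
    assert (Hbest : forall L, length L = p -> desc L -> inE L -> value L <= R1 0%nat).
    { intros L Hlen Hs Hin.
      destruct L as [|l [|j r]]; simpl in Hlen; try lia.
      destruct (table_complete alpha E r j l Hs Hin) as [Hpos HG].
      replace (S (length r)) with T in * by (unfold T; lia).
      inversion_clear Hin as [|? ? Hl Hin']; inversion_clear Hin' as [|? ? Hj _].
      rewrite hn in Hl, Hj; specialize (Hub j l Hj Hl Hj Hpos).
      cbn [chain_value]; lra. }
    (* Since [p <= n], some chain of [p] points exists, and its value is nonnegative. *)
    assert (Hatt : R1 0%nat <> -1).
    { intros Hneg; destruct (desc_sort E hE (seq 0 p)) as (L & Hperm & Hs).
      - apply seq_NoDup.
      - apply Forall_forall; intros i Hi; apply in_seq in Hi; lia.
      - assert (Hge : 0 <= value L).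
        { unfold chain_value; destruct L as [|l [|j L]]; try lra.
          apply Rplus_le_le_0_compat; [apply G_nonneg|apply D_nonneg]. }
        assert (Hle : value L <= R1 0%nat); [|lra].
        apply Hbest; [|exact Hs|].
        + rewrite <- (Permutation_length Hperm); apply length_seq.
        + apply (Permutation_Forall Hperm), Forall_forall; intros i Hi.
          apply in_seq in Hi; lia. }
    destruct Hat as [Hneg|(H8 & H13 & Hpos & Hv)]; [easy|].
    split; [|split; [|repeat split; auto]].
    + unfold core; upd; rewrite !HN by lia; rewrite HR by lia; auto.
    + apply (tab_ext _ _ _ _ _ _ Htab); auto.
      intros r Hr; upd; rewrite HN, HR by lia; auto.
    + rewrite HN by lia; exact H4.
Qed.

Definition trace_cost : nat := p * 24 + 4.

Lemma wp_trace (L : list nat) N Rg : core N Rg -> tab (fun _ _ _ => True) N Rg ->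
  N 4%nat = (p - 1)%nat -> (N 5 < n)%nat -> (N 6 < n)%nat ->
  trace alpha E (p - 1) (N 5%nat) (N 6%nat) = L ->
  WP dp_trace (fun N' R' => R' = Rg /\ map N' (seq (p + 16) p) = L /\
    N' 10%nat = (p + 1)%nat /\ N' 11%nat = (p + 15)%nat) trace_cost N Rg.
Proof.
  intros (H1 & H2 & H3 & H11 & R5) Htab H4 H5 H6 HL; unfold dp_trace, trace_cost; go; upd.
  apply wp_for with (n := (p + 1)%nat) (i0 := 1%nat) (wb := 20%nat)
    (I := fun d N' R' => R' = Rg /\ N' 12%nat = d /\ N' 10%nat = (p + 1)%nat /\
      (forall r, (1 <= r <= 3 \/ r = 11 \/ 2 * p + 40 <= r)%nat -> N' r = N r) /\
      (N' 5 < n)%nat /\ (d <= p -> N' 4 = p - d /\ N' 6 < n)%nat /\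
      (* The part written so far followed by the trace still to come is always [L]. The test handles
         [d = p + 1], where [p - d] truncates to 0 and [trace] would still produce one point. *)
      map N' (seq (p + 16) (d - 1)) ++
        (if Nat.leb d p then trace alpha E (p - d) (N' 5%nat) (N' 6%nat) else []) = L);
    try lia.
  - split; [reflexivity|]; upd; split; [reflexivity|].
    split; [rewrite H2; reflexivity|].
    split; [intros r Hr; upd; reflexivity|]; split; [exact H5|].
    split; [split; [exact H4|exact H6]|].
    replace (Nat.leb 1 p) with true by (symmetry; apply Nat.leb_le; lia).
    exact HL.
  - intros d N1 R1 Hd (-> & H12' & H10' & HN & H5' & H46 & Hmap).
    destruct H46 as [H4' H6']; [lia|].
    set (t := (p - d)%nat) in *; assert (Ht : (t < p)%nat) by (unfold t; lia).
    set (j := N1 5%nat) in *; set (l := N1 6%nat) in *.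
    destruct (addr_lt t j l) as [Hlo Hhi]; try lia.
    destruct (Htab t j l) as [_ Harg]; try lia; auto.
    assert (H11' : N1 11%nat = (p + 15)%nat) by (rewrite HN by lia; exact H11).
    assert (Harg' : N1 (addr t j l) = arg t j l) by (rewrite HN by lia; exact Harg).
    apply wp_seq; ins; rewrite H11', H12'; apply wp_seq; ins; upd; try lia.
    apply wp_seq, wp_address; try lia; upd; try (rewrite HN by lia; assumption).
    rewrite H4'; fold j l.
    apply wp_seq; ins; upd; try lia; rewrite Harg'.
    apply wp_seq, wp_move; try lia; apply wp_seq, wp_move; try lia; go; upd.
    fold j; rewrite H4'.
    split; [exact H12'|]; split; [reflexivity|]; split; [reflexivity|].
    split; [exact H10'|]; split; [intros r Hr; upd; now apply HN|].
    split; [rewrite <- hn; apply table_snd_lt; lia|].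
    split; [intros Hdp; unfold t; lia|].
    rewrite <- Hmap.
    replace (Nat.leb d p) with true by (symmetry; apply Nat.leb_le; lia).
    replace (S d - 1)%nat with (S (d - 1)) by lia.
    rewrite seq_S, map_app; cbn [map].
    replace (p + 16 + (d - 1))%nat with (p + 15 + d)%nat by lia; upd.
    rewrite <- app_assoc; f_equal.
    + apply map_ext_in; intros r Hr; apply in_seq in Hr; upd; reflexivity.
    + fold l; cbn [app]. destruct (Nat.leb_spec (S d) p) as [Hdp|Hdp].
      * replace t with (S (p - S d)) by (unfold t; lia); reflexivity.
      * replace t with 0%nat by (unfold t; lia); reflexivity.
  - intros N' R' (-> & _ & H10' & HN & _ & _ & Hmap).
    split; [reflexivity|]; rewrite (HN 11%nat) by lia; repeat split; auto.
    rewrite <- Hmap; replace (p + 1 - 1)%nat with p by lia.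
    replace (Nat.leb (p + 1) p) with false by (symmetry; apply Nat.leb_gt; lia).
    now rewrite app_nil_r.
Qed.

Lemma wp_copy N Rg : N 10%nat = (p + 1)%nat -> N 11%nat = (p + 15)%nat ->
  WP dp_copy (fun N' R' => R' = Rg /\ N' 11%nat = (p + 15)%nat /\
    (forall r, (16 <= r <= p)%nat -> N' r = N (p + 15 + r)%nat) /\
    (forall r, (1 <= r)%nat -> N' (p + 15 + r)%nat = N (p + 15 + r)%nat))
    (p * 14 + 2)%nat N Rg.
Proof.
  intros H10 H11; unfold dp_copy; apply wp_seq; ins.
  apply wp_for with (n := (p + 1)%nat) (i0 := 1%nat) (wb := 10%nat)
    (I := fun d N' R' => R' = Rg /\ N' 12%nat = d /\ N' 10%nat = (p + 1)%nat /\
      N' 11%nat = (p + 15)%nat /\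
      (forall r, (16 <= r < 15 + d)%nat -> N' r = N (p + 15 + r)%nat) /\
      (forall r, (1 <= r)%nat -> N' (p + 15 + r)%nat = N (p + 15 + r)%nat)); try lia.
  - split; [reflexivity|]; upd; repeat split; auto; try (intros; lia).
    intros r Hr; upd; reflexivity.
  - intros d N1 R1 Hd (-> & H12 & H10' & H11' & Hdone & Hsrc); go; upd;
      rewrite ?H11', ?H12; try lia.
    rewrite (Hsrc (15 + d)%nat) by lia.
    split; [reflexivity|]; split; [reflexivity|]; split; [reflexivity|].
    split; [exact H10'|]; split; [reflexivity|]; split.
    + intros r Hr; destruct (Nat.eq_dec r (15 + d)) as [->|Hne]; upd; auto.
      apply Hdone; lia.
    + intros r Hr; upd; auto.
  - intros N' R' (-> & _ & _ & H11' & Hdone & Hsrc); repeat split; auto.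
    intros r Hr; apply Hdone; lia.
Qed.

Lemma wp_fetch (k : nat) N Rg : (k <= 15)%nat -> N 0%nat = (p + 15)%nat ->
  WP (fetch k) (fun N' R' => R' = Rg /\
    (forall r, (r = 0 \/ k < r)%nat -> N' r = N r) /\
    (forall r, (1 <= r <= k)%nat -> N' r = N (p + 15 + r)%nat)) (3 * k)%nat N Rg.
Proof.
  intros Hk H0; induction k as [|k IH].
  - apply wp_skip; repeat split; auto; lia.
  - cbn [fetch]; apply wp_seq; eapply wp_call; [apply IH; lia|lia|].
    intros N1 R1 (-> & HN & Hdone); go; upd; rewrite ?(HN 0%nat), ?H0 by lia; try lia.
    replace (S k + (p + 15))%nat with (p + 15 + S k)%nat by lia.
    split; [reflexivity|]; split.
    + intros r Hr; upd; apply HN; lia.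
    + intros r Hr; destruct (Nat.eq_dec r (S k)) as [->|Hne]; upd.
      * apply HN; lia.
      * apply Hdone; lia.
Qed.

(** The 11 counts [dp_init]; [47 = 2 + 3 * 15] counts the move to [N[0]] and [fetch 15]. *)
Definition dp_cost : nat :=
  11 + fill_cost + final_cost + trace_cost + (p * 14 + 2) + 47.

Lemma wp_dp_prog :
  WP dp_prog (fun N' R' => optimal alpha E p (map N' (seq 1 p)) /\
      R' 0%nat = disp_value alpha E (map N' (seq 1 p))) dp_cost
    (fun _ => 0%nat) (fun _ => 0).
Proof.
  unfold dp_prog, dp_cost; apply wp_seq; unfold dp_init.
  go.
  eapply wp_call; [apply wp_fill| |].
  - unfold core; upd; repeat split; lia.
  (* Level 0 is never written: registers start at 0, and [table] is [(0, 0)] everywhere at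
     [t = 0]. *)
  - intros t j l Ht Hj Hl ->; destruct (addr_lt 0 j l) as [Hlo Hhi]; try lia.
    upd; split; reflexivity.
  - upd; reflexivity.
  - upd; reflexivity.
  - lia.
  - intros N1 R1 (Hcore1 & Htab1 & H4).
    apply wp_seq; eapply wp_call; [now apply wp_final|lia|].
    clear N1 R1 Hcore1 Htab1 H4.
    intros N1 R1 (Hcore & Htab & H4 & H5 & H6 & Hpos & Hv & Hbest).
    set (L := trace alpha E (p - 1) (N1 5%nat) (N1 6%nat)).
    assert (Hopt : optimal alpha E p L /\ R1 0%nat = disp_value alpha E L).
    { destruct (table_sound alpha E (p - 2) (N1 5%nat) (N1 6%nat))
        as (Hs & Hin & Hlen & HG & r & Hr); try lia.
      { replace (S (p - 2)) with (p - 1)%nat by lia; exact Hpos. }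
      replace (S (p - 2)) with (p - 1)%nat in * by lia; fold L in Hs, Hin, Hlen, HG, Hr.
      assert (HvL : value L = R1 0%nat).
      { rewrite Hv, <- HG, Hr; reflexivity. }
      rewrite <- HvL; apply optimal_of_desc; auto; try lia.
      intros L' H1 H2 H3; rewrite HvL; auto. }
    apply wp_seq; eapply wp_call; [apply (wp_trace L); auto|lia|].
    intros N2 R2 (-> & Hmap & H10 & H11).
    apply wp_seq; eapply wp_call; [now apply wp_copy|lia|].
    intros N3 R3 (-> & H11' & Hlow & Hhigh).
    apply wp_seq, wp_move; try lia.
    eapply wp_call; [apply wp_fetch; [lia|upd; exact H11']|lia|].
    intros N4 R4 (-> & HN & Hf).
    replace (map N4 (seq 1 p)) with L; [exact Hopt|].
    rewrite <- Hmap; replace (p + 16)%nat with (p + 15 + 1)%nat by lia.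
    rewrite <- map_add_seq.
    rewrite map_map; apply map_ext_in; intros r Hr; apply in_seq in Hr.
    destruct (Nat.le_gt_cases r 15) as [Hr15|Hr15].
    + rewrite Hf by lia; upd; rewrite Hhigh by lia; reflexivity.
    + rewrite HN by lia; upd; rewrite Hlow by lia; reflexivity.
Qed.

Lemma dp_cost_le : (dp_cost <= 400 * p * n ^ 3)%nat.
Proof.
  unfold dp_cost, fill_cost, final_cost, trace_cost, cell_cost.
  simpl Nat.pow; rewrite Nat.mul_1_r.
  assert (H1 : (1 <= n)%nat) by lia.
  assert (H2 : (n <= n * n)%nat) by nia.
  assert (H3 : (n * n <= n * (n * n))%nat) by nia.
  set (c := (n * (n * n))%nat) in *.
  (* 80 and 56 are the sums of the coefficients, since each lower power of [n] is at most [n^3]. *)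
  assert (H4 : (n * (n * (n * 24 + 40 + 4) + 6) + 6 <= 80 * c)%nat) by (unfold c in *; nia).
  assert (H5 : (n * (n * 30 + 6) + 20 <= 56 * c)%nat) by (unfold c in *; nia).
  nia.
Qed.

End Program.

(** * Final bounds *)

Lemma dp_solves (alpha : R) (E : list pt) (p : nat) : 0 < alpha -> pareto_set E ->
  (2 <= p <= length E)%nat ->
  solves_within alpha (compile dp_prog 0 ++ [Halt]) E p
    (400 * p * length E ^ 3) (400 * p * length E ^ 2).
Proof.
  intros Ha HE Hp.
  assert (H : solves_within alpha (compile dp_prog 0 ++ [Halt]) E p
    (400 * p * length E ^ 3) (2 * p + 50 + p * length E * length E)).
  { apply wp_solves; eapply wp_call; [apply wp_dp_prog; auto| |auto].
    now apply dp_cost_le with (E := E). }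
  destruct H as (H1 & H2 & H3); split; [exact H1|split; [|exact H3]].
  eapply Nat.le_trans; [exact H2|]; simpl Nat.pow; rewrite Nat.mul_1_r.
  assert (4 <= length E * length E)%nat by nia.
  set (c := (length E * length E)%nat) in *.
  replace (p * length E * length E)%nat with (p * c)%nat by (unfold c; ring). nia.
Qed.

(** A halted run stays in its final state, so extra fuel is harmless. *)
Lemma solves_within_mono (alpha : R) (P : list instr) (E : list pt)
  (p T T' M M' : nat) : (T <= T')%nat -> (M <= M')%nat ->
  solves_within alpha P E p T M -> solves_within alpha P E p T' M'.
Proof.
  intros HT HM (Hstop & Hmem & Hout); unfold solves_within.
  replace (run alpha E p P T' init_state) with (run alpha E p P T init_state);
    [split; [exact Hstop|split; [lia|exact Hout]]|].
  revert T' HT Hstop; generalize init_state; clear Hmem Hout.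
  induction T as [|T IH]; intros s T' HT Hstop.
  - simpl in *; destruct T'; simpl; [reflexivity|now rewrite Hstop].
  - destruct T' as [|T']; [lia|]; simpl in *.
    destruct (step alpha E p P s); [apply IH; [lia|exact Hstop]|reflexivity].
Qed.

Theorem theorem3 (alpha : R) (halpha : 0 < alpha) :
  (* polynomially solvable *)
  (exists (P : list instr) (k C : nat), forall (E : list pt) (p : nat),
     (2 <= p <= length E)%nat -> pareto_set E ->
     solves_within alpha P E p (C * length E ^ k) (C * length E ^ k)) /\
  (* p = 2 : O(n) time, O(1) additional memory *)
  (exists (P : list instr) (C : nat), forall E : list pt,
     (2 <= length E)%nat -> pareto_set E ->
     solves_within alpha P E 2 (C * length E) C) /\
  (* p = 3 : O(n) time, O(1) additional memory *)
  (exists (P : list instr) (C : nat), forall E : list pt,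
     (3 <= length E)%nat -> pareto_set E ->
     solves_within alpha P E 3 (C * length E) C) /\
  (* p = 4 : O(n^2) time, O(1) additional memory *)
  (exists (P : list instr) (C : nat), forall E : list pt,
     (4 <= length E)%nat -> pareto_set E ->
     solves_within alpha P E 4 (C * length E ^ 2) C) /\
  (* p = 5 : O(n^3) time, O(1) additional memory *)
  (exists (P : list instr) (C : nat), forall E : list pt,
     (5 <= length E)%nat -> pareto_set E ->
     solves_within alpha P E 5 (C * length E ^ 3) C) /\
  (* p > 5 : O(p n^3) time, O(p n^2) memory *)
  (exists (P : list instr) (C : nat), forall (E : list pt) (p : nat),
     (5 < p <= length E)%nat -> pareto_set E ->
     solves_within alpha P E p (C * p * length E ^ 3) (C * p * length E ^ 2)).
Proof.
  split; [|split; [|split; [|split; [|split]]]].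
  - exists (compile dp_prog 0 ++ [Halt]), 4%nat, 400%nat; intros E p Hp HE.
    (* As [p <= n], the time [p n^3] is at most [n^4], and the memory [p n^2] is at most [n^3]. *)
    refine (solves_within_mono _ _ _ _ _ _ _ _ _ _ (dp_solves alpha E p halpha HE Hp)).
    + rewrite (Nat.pow_succ_r' _ 3); nia.
    + apply Nat.le_trans with (400 * length E ^ 3)%nat.
      * rewrite (Nat.pow_succ_r' _ 2); nia.
      * apply Nat.mul_le_mono_l, Nat.pow_le_mono_r; lia.
  - destruct (fixed_solvable alpha 0 halpha) as (P & C & H); exists P, C; intros E Hn HE.
    specialize (H E Hn HE); rewrite Nat.pow_1_r in H; exact H.
  - destruct (fixed_solvable alpha 1 halpha) as (P & C & H); exists P, C; intros E Hn HE.
    specialize (H E Hn HE); rewrite Nat.pow_1_r in H; exact H.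
  - exact (fixed_solvable alpha 2 halpha).
  - exact (fixed_solvable alpha 3 halpha).
  - exists (compile dp_prog 0 ++ [Halt]), 400%nat; intros E p Hp HE.
    apply dp_solves; auto; lia.
Qed.
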